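(* Let $\Omega\subset \mathbb R^2$ be a nonempty open set. (i) There exists a packing $\mathcal P_{\Omega}$ inside $\Omega$ by convex, smooth curves whose residual set has $\sigma$-finite Hausdorff $1$-measure and, in particular, Hausdorff dimension equal to $1$. (ii) There exists a packing $\mathcal P_{\Omega}$ inside $\Omega$ by strictly convex, smooth curves whose residual set has Hausdorff dimension equal to $1$.
   Context: A Jordan region is the open bounded region enclosed by a Jordan curve in $\mathbb R^2$. A packing inside an open set $\Omega\subset\mathbb R^2$ is a countably infinite collection $\mathcal P_\Omega=\{D_i\}_{i\in\mathbb N}$ of open Jordan regions with $D_i\subset\Omega$ for all $i$ and $D_i\cap D_j=\emptyset$ for $i\ne j$ (closures may intersect); it is called a packing by the curves $\partial D_i$. Its residual set is $\mathcal S=\Omega\setminus\bigcup_{i\in\mathbb N}D_i$. A Jordan curve $C$ is convex if the line segment between any two points of $C$ is contained in the closed region bounded by $C$; it is strictly convex if it is convex and contains no (nondegenerate) line segment. A smooth Jordan curve means a $C^2$-smooth one: it has a twice continuously differentiable parametrization $\gamma:\mathbb R/\mathbb Z\to C$ with $\dot\gamma\neq0$ everywhere. A set has $\sigma$-finite Hausdorff $1$-measure if it is a countable union of sets of finite Hausdorff $1$-measure $\mathscr H^1$. *)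

(* Defs.v *)
From HB Require Import structures.
From mathcomp Require Import all_boot all_order all_algebra.
From mathcomp Require Import all_classical all_reals all_analysis.

Set Implicit Arguments.
Unset Strict Implicit.
Unset Printing Implicit Defensive.

Import Order.TTheory GRing.Theory Num.Theory.
Import numFieldNormedType.Exports.

Local Open Scope classical_set_scope.
Local Open Scope ring_scope.

Section JordanCurves.
Context {R : realType}.
Implicit Types (C D : set (R * R)) (p q : R * R).

(* Parametrizations of closed curves by R/Z are represented by their
   1-periodic lifts to R; "jordan_param" says that the induced map on R/Z is
   continuous and injective. *)
Definition jordan_param (gamma : R -> R * R) : Prop :=
  [/\ continuous gamma,
      forall t, gamma (t + 1) = gamma t &
      {in `[0, 1[ &, injective gamma}].

Definition jordan_curve C : Prop :=
  exists2 gamma : R -> R * R, jordan_param gamma & C = range gamma.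

(* By the Jordan curve theorem, the complement of a Jordan curve has exactly
   one bounded component; the set below is the union of all of them. *)
Definition enclosed C : set (R * R) :=
  [set x | ~ C x /\ bounded_set (connected_component (~` C) x)].

Definition jordan_region D : Prop :=
  exists2 C, jordan_curve C & D = enclosed C.

Definition boundary D : set (R * R) := closure D `\` D°.

Definition segment p q : set (R * R) :=
  [set (1 - t) *: p + t *: q | t in `[0, 1]].

Definition convex_curve C : Prop :=
  jordan_curve C /\
  forall p q, C p -> C q -> segment p q `<=` closure (enclosed C).

Definition strictly_convex_curve C : Prop :=
  convex_curve C /\ forall p q, segment p q `<=` C -> p = q.

Definition smooth_curve C : Prop :=
  exists gamma : R -> R * R,
    [/\ jordan_param gamma, C = range gamma,
        (forall t, derivable gamma t 1 /\ derivable (gamma^`())%classic t 1),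
        continuous (gamma^`(2))%classic &
        forall t, (gamma^`())%classic t != 0].

End JordanCurves.

Section Packings.
Context {R : realType}.
Implicit Types (Omega : set (R * R)) (D : nat -> set (R * R)).

Definition packing Omega D : Prop :=
  [/\ forall i, jordan_region (D i),
      forall i, D i `<=` Omega &
      forall i j, i <> j -> D i `&` D j = set0].

Definition packing_by (P : set (R * R) -> Prop) Omega D : Prop :=
  packing Omega D /\ forall i, P (boundary (D i)).

Definition residual_set Omega D : set (R * R) := Omega `\` \bigcup_i D i.

End Packings.

Section Hausdorff.
Context {R : realType}.
Implicit Types (S U : set (R * R)) (s : R).
Local Open Scope ereal_scope.

(* The library norm on R * R is the max norm, so the Euclidean distance is
   written out. *)
Definition eucl_dist (p q : R * R) : R :=
  Num.sqrt ((p.1 - q.1) ^+ 2 + (p.2 - q.2) ^+ 2).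

Definition diam U : \bar R :=
  ereal_sup [set (eucl_dist p.1 p.2)%:E | p in U `*` U].

(* diam(U)^s; the empty set contributes 0 to every cover, also for s = 0. *)
Definition diam_pow s U : \bar R :=
  if `[< U = set0 >] then 0 else poweR (diam U) s.

Definition hausdorff_content s (delta : R) S : \bar R :=
  ereal_inf [set \sum_(i <oo) diam_pow s (U i) |
    U in [set U : nat -> set (R * R) |
      S `<=` \bigcup_i U i /\ forall i, diam (U i) <= delta%:E]].

Definition hausdorff_measure s S : \bar R :=
  ereal_sup [set hausdorff_content s delta S | delta in [set d : R | (0 < d)%R]].

Definition sigma_finite_hausdorff1 S : Prop :=
  exists2 F : nat -> set (R * R),
    S = \bigcup_i F i & forall i, hausdorff_measure 1 (F i) < +oo.

Definition hausdorff_dim S : \bar R :=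
  ereal_inf [set s%:E | s in [set s : R | (0 <= s)%R /\ hausdorff_measure s S = 0]].

End Hausdorff.

(* Main.v *)
(* Tile the open set by half-open dyadic squares and put into each of them a
   smooth convex region that almost fills it: a scaled copy of the unit ball of
   a C^2 smoothing of the max norm.  What remains of the open squares outside
   the closed regions is again open, so the construction can be iterated.  The
   residual set is then contained in countably many Lipschitz arcs (edges of
   squares and boundaries of regions) together with the intersection L of the
   remaining open sets.

   (i) If the smoothing only affects a small cone around the diagonals, the
   region has flat sides and misses only four small corners of its square, so
   the remaining sets have small H^1-content and H^1(L) = 0.
   (ii) Adding a small multiple of the squared Euclidean norm makes the region
   strictly convex; it then misses a thin ring, which has small H^s-content for
   any given s > 1.  Letting s decrease to 1 along the iteration gives
   H^s(L) = 0 for all s > 1.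

   Conversely, the bottom edge of a square of the first tiling stays in the
   residual set, whose dimension is therefore at least 1. *)
Require Import Defs.
From mathcomp Require Import all_boot all_order all_algebra.
From mathcomp Require Import all_classical all_reals all_analysis.
From mathcomp Require Import ring lra.
Import Order.TTheory GRing.Theory Num.Theory.
Import numFieldNormedType.Exports.

Set Implicit Arguments.
Unset Strict Implicit.
Unset Printing Implicit Defensive.

Local Open Scope classical_set_scope.
Local Open Scope ring_scope.

(** * Hausdorff content *)

Section HausdorffContent.
Context {R : realType}.
Implicit Types (A B U : set (R * R)) (s d delta : R) (p q : R * R).
Local Open Scope ereal_scope.

(** The gauge of the smoothed square starts from max(x^2, y^2) = (x^2 + y^2)/2 + |x^2 - y^2|/2,
    where the absolute value is rounded at the scale e (x^2 + y^2) so that the result stays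
    homogeneous of degree 2. Convexity is not inherited from the rounding, because x^2 - y^2 is not
    convex; it holds because the gauge is a supremum of quadratic forms A x^2 + B y^2 with A, B >=
    k. In (ii) the exponent 1 is out of reach of this argument: the ring left around a strictly
    convex region projects onto almost a full side of the square, so the diameters in a cover cannot
    have a small sum. Hence each level works with its own exponent above 1. The bounds can be
    compared because, for sets of diameter at most 1, a larger exponent gives smaller powers. A
    tiling may have infinitely many squares, so the i-th one receives the share 2^-(i+1) of the
    permitted content; its scaling factor is at most 1 and does not increase the content. *)

Lemma eucl_dist_ge0 p q : (0 <= eucl_dist p q)%R.
Proof. exact: sqrtr_ge0. Qed.

Lemma eucl_dist_le_add p q :
  (eucl_dist p q <= `|p.1 - q.1| + `|p.2 - q.2|)%R.
Proof.
rewrite /eucl_dist -[leRHS]ger0_norm ?addr_ge0// -sqrtr_sqr.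
apply: ler_wsqrtr.
rewrite [leRHS]sqrrD !real_normK ?num_real// lerD2r lerDl mulrn_wge0//.
Qed.

Lemma eucl_dist_fst p q : (`|p.1 - q.1| <= eucl_dist p q)%R.
Proof.
by rewrite /eucl_dist -sqrtr_sqr; apply: ler_wsqrtr; rewrite lerDl sqr_ge0.
Qed.

Lemma diam_le U d : (forall p q, U p -> U q -> (eucl_dist p q <= d)%R) ->
  diam U <= d%:E.
Proof.
by move=> h; apply: ge_ereal_sup => _ [[p q] [/= Up Uq] <-]; rewrite lee_fin h.
Qed.

Lemma diam_ge U p q : U p -> U q -> (eucl_dist p q)%:E <= diam U.
Proof. by move=> Up Uq; apply: ereal_sup_ubound; exists (p, q). Qed.

Lemma diam_ge0 U : U !=set0 -> 0 <= diam U.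
Proof.
by move=> [p Up]; apply: le_trans (diam_ge Up Up); rewrite lee_fin eucl_dist_ge0.
Qed.

Lemma diam_set0 : diam (set0 : set (R * R)) = -oo.
Proof. by rewrite /diam set0X image_set0 ereal_sup0. Qed.

Lemma diam_pow_ge0 s U : 0 <= diam_pow s U.
Proof. by rewrite /diam_pow; case: ifP => // _; exact: poweR_ge0. Qed.

Lemma diam_pow_set0 s : diam_pow s (set0 : set (R * R)) = 0.
Proof. by rewrite /diam_pow; case: asboolP. Qed.

Lemma diam_pow_le s U d : (0 <= s)%R -> (0 <= d)%R -> diam U <= d%:E ->
  diam_pow s U <= (d `^ s)%:E.
Proof.
move=> s0 d0 Ud; rewrite /diam_pow; case: asboolP => [_|/eqP/set0P U0].
  by rewrite lee_fin powR_ge0.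
by rewrite -poweR_EFin; apply: gt0_ler_poweR => //;
  rewrite in_itv/= leey ?andbT ?diam_ge0 ?lee_fin.
Qed.

Lemma le_diam_pow s s' U : (0 < s <= s')%R -> diam U <= 1 ->
  diam_pow s' U <= diam_pow s U.
Proof.
move=> /andP[s0 ss'] U1; rewrite /diam_pow; case: asboolP => // /eqP/set0P /diam_ge0.
case: (diam U) U1 => // r; rewrite !lee_fin => r1; rewrite le_eqVlt => /orP[/eqP<-|r0].
  by rewrite !powR0// gt_eqF// (lt_le_trans s0).
by apply: ger_powR => //; rewrite r0.
Qed.

Lemma diam_pow_image s U (f : R * R -> R * R) : (0 <= s)%R ->
  (forall p q, (eucl_dist (f p) (f q) <= eucl_dist p q)%R) ->
  diam_pow s (f @` U) <= diam_pow s U.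
Proof.
move=> s0 hf; rewrite /diam_pow; case: asboolP => [_|/eqP/set0P fU].
  by case: asboolP => // _; exact: poweR_ge0.
have U0 : U !=set0 by case: fU => _ [x Ux _]; exists x.
case: asboolP => [U00|_]; first by move: U0; rewrite U00 => -[].
apply: gt0_ler_poweR => //; rewrite ?in_itv/= ?leey ?andbT ?diam_ge0//.
apply: ge_ereal_sup => _ [[_ _] [/= [p Up <-] [q Uq <-]] <-].
by apply: le_trans (diam_ge Up Uq); rewrite lee_fin.
Qed.

Lemma content_ge0 s delta A : 0 <= hausdorff_content s delta A.
Proof.
apply: le_ereal_inf_tmp => _ [U _ <-].
by apply: nneseries_ge0 => n _ _; exact: diam_pow_ge0.
Qed.

Lemma content_le_cover s delta A (U : nat -> set (R * R)) :
  A `<=` \bigcup_i U i -> (forall i, diam (U i) <= delta%:E) ->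
  hausdorff_content s delta A <= \sum_(i <oo) diam_pow s (U i).
Proof. by move=> AU Ud; apply: ereal_inf_lbound; exists U. Qed.

Lemma content_lt_cover s delta A (x : R) : hausdorff_content s delta A < x%:E ->
  exists U : nat -> set (R * R), [/\ A `<=` \bigcup_i U i,
    forall i, diam (U i) <= delta%:E & \sum_(i <oo) diam_pow s (U i) < x%:E].
Proof. by move=> /ereal_inf_lt[_ [U [AU Ud] <-] h]; exists U. Qed.

(** For sets of diameter at most 1 the larger exponent gives the smaller power, so exponent and mesh
    can change together. This is how levels with different exponents are compared. *)
Lemma le_content s s' delta delta' A B : A `<=` B -> (0 < s' <= s)%R ->
  (delta' <= delta)%R -> (delta' <= 1)%R ->
  hausdorff_content s delta A <= hausdorff_content s' delta' B.
Proof.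
move=> AB ss dd d1; apply: le_ereal_inf_tmp => _ [U [BU Ud] <-].
apply: le_trans (content_le_cover s (subset_trans AB BU) _) _.
  by move=> i; apply: le_trans (Ud i) _; rewrite lee_fin.
apply: lee_nneseries => [n _ _|n _]; first exact: diam_pow_ge0.
by apply: le_diam_pow => //; apply: le_trans (Ud n) _; rewrite lee_fin.
Qed.

Lemma content_subset s delta A B : A `<=` B ->
  hausdorff_content s delta A <= hausdorff_content s delta B.
Proof.
move=> AB; apply: le_ereal_inf_tmp => _ [U [BU Ud] <-].
by apply: content_le_cover Ud; exact: subset_trans BU.
Qed.

Lemma content_finite_cover s delta d A (N : nat) (U : nat -> set (R * R)) :
  (0 <= s)%R -> (0 <= d <= delta)%R -> A `<=` \bigcup_(i < N) U i ->
  (forall i, (i < N)%N -> diam (U i) <= d%:E) ->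
  hausdorff_content s delta A <= (N%:R * d `^ s)%:E.
Proof.
move=> s0 /andP[d0 dd] AU Ud; pose V i := if (i < N)%N then U i else set0.
have Vd i : diam (V i) <= d%:E.
  by rewrite /V; case: ifP => [/Ud//|_]; rewrite diam_set0 leNye.
apply: (@le_trans _ _ (\sum_(i <oo) diam_pow s (V i))).
  apply: content_le_cover => [x /AU[i/= iN Uix]|i].
    by exists i => //; rewrite /V iN.
  by apply: le_trans (Vd i) _; rewrite lee_fin.
rewrite (nneseries_split 0 N) => [|k _]; last exact: diam_pow_ge0.
rewrite add0n eseries0 => [|i Ni _]; last by rewrite /V ltnNge Ni diam_pow_set0.
rewrite adde0.
have -> : (N%:R * d `^ s)%:E = \sum_(0 <= i < N) (d `^ s)%:E.
  by rewrite sumEFin big_const_nat subn0 iter_addr_0 mulr_natl.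
by apply: lee_sum => i _; apply: diam_pow_le => //.
Qed.

(** Covers of the [A n], each within e / 2^(n+1) of the content, are merged into one sequence along
    a bijection between [nat] and [nat * nat]. *)
Lemma content_bigcup s delta (A : nat -> set (R * R)) :
  hausdorff_content s delta (\bigcup_i A i) <=
  \sum_(i <oo) hausdorff_content s delta (A i).
Proof.
have [[i ioo]|] := pselect (exists i, hausdorff_content s delta (A i) = +oo).
  rewrite (eseries_pinfty _ _ ioo) ?leey// => n _.
  by rewrite -ltNye (lt_le_trans _ (content_ge0 _ _ _)).
rewrite -forallNE => Aoo.
apply/lee_addgt0Pr => _/posnumP[e].
rewrite (le_trans _ (epsilon_trick _ _ _))//; last first.
  by move=> n; exact: content_ge0.
have /choice[G PG] : forall n, exists B : nat -> set (R * R),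
   [/\ A n `<=` \bigcup_i B i, forall i, diam (B i) <= delta%:E &
   \sum_(k <oo) diam_pow s (B k) <=
     hausdorff_content s delta (A n) + (e%:num / (2 ^ n.+1)%:R)%:E].
  move=> n; have := content_ge0 s delta (A n).
  have := Aoo n.
  case E : (hausdorff_content s delta (A n)) => [r| |] // _ _.
  have : hausdorff_content s delta (A n) < (r + e%:num / (2 ^ n.+1)%:R)%:E.
    by rewrite E lte_fin ltrDl.
  move=> /content_lt_cover[U [h1 h2 h3]]; exists U; split=> //.
  by rewrite -EFinD ltW.
have G0 (x : nat * nat) : 0 <= (diam_pow s \o uncurry G) x.
  exact: diam_pow_ge0.
apply: (@le_trans _ _ (\esum_(i in setT) (diam_pow s \o uncurry G) i)).
  have /card_esym/ppcard_eqP[f] := card_nat2.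
  rewrite (reindex_esum [set: nat] _ f)// -nneseries_esumT//.
  apply: (@content_le_cover _ _ _ (uncurry G \o f)) => [x [n _ Anx]|i].
    have [/(_ x Anx)[k _ Gx] _ _] := PG n.
    by exists (f^-1%FUN (n, k)) => //=; rewrite invK ?inE.
  by rewrite /= /uncurry; case: (f i) => a b; have [_ h _] := PG a.
rewrite -setXTT [leLHS](_ : _ = \sum_(i <oo) \sum_(j <oo) diam_pow s (G i j)).
  apply: lee_nneseries => [n _ _|n _]; last by have [] := PG n.
  by apply: nneseries_ge0 => *; exact: diam_pow_ge0.
rewrite nneseries_esumT; last first.
  by move=> n; apply: nneseries_ge0 => *; exact: diam_pow_ge0.
rewrite (eq_esum (b := fun i => \esum_(j in setT) diam_pow s (G i j))); last first.
  by move=> i _; rewrite nneseries_esumT// => n; exact: diam_pow_ge0.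
rewrite esum_esum => [|i j _ _]; last exact: diam_pow_ge0.
rewrite [X in \esum_(i in X) _ = _](_ : _ = [set: nat] `*`` fun=> [set: nat]).
  by apply: eq_esum => -[].
by apply/seteqP; split.
Qed.

Lemma content_contraction s delta A (f : R * R -> R * R) : (0 <= s)%R ->
  (forall p q, (eucl_dist (f p) (f q) <= eucl_dist p q)%R) ->
  hausdorff_content s delta (f @` A) <= hausdorff_content s delta A.
Proof.
move=> s0 hf; apply: le_ereal_inf_tmp => _ [U [AU Ud] <-].
apply: (@le_trans _ _ (\sum_(i <oo) diam_pow s (f @` U i))).
  apply: content_le_cover => [_ [x /AU[i _ Uix] <-]|i].
    by exists i => //; exists x.
  apply: ge_ereal_sup => _ [[_ _] [/= [p Up <-] [q Uq <-]] <-].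
  by apply: le_trans (Ud i); apply: le_trans (diam_ge Up Uq); rewrite lee_fin.
by apply: lee_nneseries => [n _ _|n _]; [exact: diam_pow_ge0|exact: diam_pow_image].
Qed.

Lemma hausdorff_measure_eq0 s A :
  (forall delta, (0 < delta)%R -> hausdorff_content s delta A <= 0) ->
  hausdorff_measure s A = 0.
Proof.
move=> h; apply/eqP; rewrite eq_le; apply/andP; split.
  by apply: ge_ereal_sup => _ [d d0 <-]; exact: h.
apply: (@le_trans _ _ (hausdorff_content s 1 A)); first exact: content_ge0.
by apply: ereal_sup_ubound; exists 1%R => //=.
Qed.

Lemma hausdorff_measure0_content s A delta : (0 < delta)%R ->
  hausdorff_measure s A = 0 -> hausdorff_content s delta A = 0.
Proof.
move=> d0 A0; apply/eqP; rewrite eq_le content_ge0 andbT -A0.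
by apply: ereal_sup_ubound; exists delta.
Qed.

Lemma hausdorff_measure0_subset s A B : A `<=` B ->
  hausdorff_measure s B = 0 -> hausdorff_measure s A = 0.
Proof.
move=> AB B0; apply: hausdorff_measure_eq0 => d d0.
by rewrite -(hausdorff_measure0_content d0 B0) content_subset.
Qed.

Lemma hausdorff_measure0_bigcup s (A : nat -> set (R * R)) :
  (forall i, hausdorff_measure s (A i) = 0) ->
  hausdorff_measure s (\bigcup_i A i) = 0.
Proof.
move=> A0; apply: hausdorff_measure_eq0 => d d0.
apply: le_trans (content_bigcup _ _ _) _.
by rewrite eseries0// => i _ _; exact: hausdorff_measure0_content.
Qed.

Lemma hausdorff_measure0_setU s A B : hausdorff_measure s A = 0 ->
  hausdorff_measure s B = 0 -> hausdorff_measure s (A `|` B) = 0.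
Proof.
move=> A0 B0; rewrite -bigcup2E; apply: hausdorff_measure0_bigcup => -[|[|i]]//=.
exact: hausdorff_measure0_subset A0.
Qed.

End HausdorffContent.

(** * Measures of Lipschitz arcs and horizontal segments *)

Section LipschitzArcs.
Context {R : realType}.
Implicit Types (A : set (R * R)) (s d delta K : R).

Lemma powR_small (a e : R) : 0 < a -> 0 < e ->
  exists2 d : R, 0 < d & forall x : R, 0 <= x <= d -> x `^ a <= e.
Proof.
move=> a0 e0; exists (e `^ a^-1); first exact: powR_gt0.
move=> x /andP[x0 xd]; apply: (@le_trans _ _ ((e `^ a^-1) `^ a)).
  by apply: ge0_ler_powR => //; rewrite ?nnegrE ?ltW// powR_gt0.
by rewrite -powRrM mulVf ?gt_eqF// powRr1// ltW.
Qed.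

Lemma inv_nat_small (K d : R) : 0 < d -> exists N, K / N.+1%:R <= d.
Proof.
move=> d0; exists (Num.truncn (`|K| / d)).
rewrite ler_pdivrMr// (le_trans (ler_norm _))// -ler_pdivrMl// mulrC.
by rewrite ltW// truncnS_gt.
Qed.

(** Only inclusion in the image is asked, so that subsets of arcs qualify; the residual set is cut
    into such subsets. *)
Definition lipschitz_arc A := exists (f : R -> R * R) K,
  [/\ 0 < K, forall x y : R, 0 <= x <= 1 -> 0 <= y <= 1 ->
     eucl_dist (f x) (f y) <= K * `|x - y| & A `<=` f @` `[0, 1]].

(** The parameter interval is cut into [N.+1] equal pieces, whose images have diameter at most K /
    (N+1). One constant serves all exponents and meshes. *)
Lemma content_lipschitz_arc A : lipschitz_arc A -> exists2 K : R, 0 < K &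
  forall (s delta : R) N, 0 <= s -> K / N.+1%:R <= delta ->
  (hausdorff_content s delta A <= (N.+1%:R * (K / N.+1%:R) `^ s)%:E)%E.
Proof.
move=> [f [K [K0 fK Af]]]; exists K => // s delta N s0 Kd.
have N0 : 0 < N.+1%:R :> R by [].
apply: (@content_finite_cover _ _ _ _ _ _
  (fun i => f @` `[i%:R / N.+1%:R, i.+1%:R / N.+1%:R])) => //.
- by rewrite divr_ge0// ltW.
- move=> _ /Af[x /= + <-]; rewrite in_itv/= => /andP[x0 x1].
  have [xN|xN] := ltnP (Num.truncn (x * N.+1%:R)) N.+1.
    exists (Num.truncn (x * N.+1%:R)) => //; exists x => //=.
    rewrite in_itv/= ler_pdivrMr// ler_pdivlMr//.
    have := @truncn_itv _ (x * N.+1%:R); rewrite mulr_ge0// => /(_ isT)/andP[-> /ltW].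
    by [].
  (* The endpoint 1 truncates to [N.+1] and is put into the last piece. *)
  have x1' : x = 1.
    apply/eqP; rewrite eq_le x1/=.
    have := @truncn_itv _ (x * N.+1%:R); rewrite mulr_ge0// => /(_ isT)/andP[h _].
    rewrite -(ler_pM2r N0) mul1r; apply: le_trans h.
    by rewrite ler_nat.
  exists N => //=; exists 1; rewrite ?x1'//= in_itv/= divff ?gt_eqF// lexx andbT.
  by rewrite ler_pdivrMr// mul1r ler_nat.
- move=> i iN; apply: diam_le => _ _ [x /= + <-] [y /= + <-].
  rewrite !in_itv/= => /andP[ix xi] /andP[iy yi].
  have i1 : i.+1%:R / N.+1%:R <= 1 :> R by rewrite ler_pdivrMr// mul1r ler_nat.
  have i0 : 0 <= i%:R / N.+1%:R :> R by rewrite divr_ge0.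
  apply: le_trans (fK _ _ _ _) _.
  - by rewrite (le_trans i0 ix) (le_trans xi i1).
  - by rewrite (le_trans i0 iy) (le_trans yi i1).
  rewrite ler_pM2l//.
  have -> : N.+1%:R^-1 = i.+1%:R / N.+1%:R - i%:R / N.+1%:R :> R.
    by rewrite -mulrBl -natrB// subSnn mul1r.
  by rewrite ler_norml lerNl opprB !lerB.
Qed.

Lemma lipschitz_arc_measure1 A : lipschitz_arc A ->
  (hausdorff_measure 1 A < +oo)%E.
Proof.
move=> /content_lipschitz_arc[K K0 h]; apply: (@le_lt_trans _ _ K%:E); last exact: ltry.
apply: ge_ereal_sup => _ [d /= d0 <-].
have [N KN] := inv_nat_small K d0.
apply: le_trans (h _ _ _ ler01 KN) _.
have KN0 : 0 <= K / N.+1%:R by rewrite divr_ge0// ltW.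
by rewrite lee_fin (powRr1 KN0) mulrC divfK ?pnatr_eq0.
Qed.

Lemma lipschitz_arc_measure0 A s : 1 < s -> lipschitz_arc A ->
  hausdorff_measure s A = 0%E.
Proof.
move=> s1 /content_lipschitz_arc[K K0 h]; apply: hausdorff_measure_eq0 => d d0.
apply/lee_addgt0Pr => e e0; rewrite add0e.
(* The cover bound equals K (K / (N+1))^(s - 1), hence the target e / K. *)
have [eta eta0 heta] : exists2 d : R, 0 < d &
    forall x : R, 0 <= x <= d -> x `^ (s - 1) <= e / K.
  by apply: powR_small; rewrite ?subr_gt0// divr_gt0.
have [N KN] : exists N, K / N.+1%:R <= Num.min d eta.
  by apply: inv_nat_small; rewrite lt_min d0.
move: KN; rewrite le_min => /andP[KN1 KN2].
apply: le_trans (h s d N _ KN1) _; first lra.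
have KN0 : 0 <= K / N.+1%:R by rewrite divr_ge0// ltW.
rewrite lee_fin -(mulr_powRB1 KN0); last lra.
rewrite mulrA [X in X * _]mulrC divfK ?pnatr_eq0// mulrC -ler_pdivlMr//.
by apply: heta; rewrite KN2 KN0.
Qed.

(** The number [e n] is both mesh and bound: once it is below 1, the given mesh and the tolerance,
    [le_content] passes from the exponent [t n] to [s]. *)
Lemma content_le0_measure0 s (e : nat -> R) (t : nat -> R) A :
  (forall n, 0 < t n) ->
  (\forall n \near \oo, t n <= s) -> e @ \oo --> (0 : R) ->
  (forall n, hausdorff_content (t n) (e n) A <= (e n)%:E)%E ->
  hausdorff_measure s A = 0%E.
Proof.
move=> t0 ts e0 h; apply: hausdorff_measure_eq0 => d d0.
apply/lee_addgt0Pr => x x0; rewrite add0e.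
have /(@cvgr_lt _ _ _ _) el := e0.
near \oo => n; apply: (@le_trans _ _ (e n)%:E).
  apply: le_trans (h n); apply: le_content => //.
  - by rewrite t0; near: n.
  - by apply/ltW; near: n; exact: el.
  - by apply/ltW; near: n; exact: el.
by rewrite lee_fin; apply/ltW; near: n; exact: el.
Unshelve. all: by end_near. Qed.

(* Projecting a cover of a horizontal segment to the first axis, countable
   subadditivity of Lebesgue measure bounds [\sum diam], hence [\sum diam^s]
   from below. *)
Lemma segment_measure_neq0 s (a b y : R) A : a < b -> 0 <= s < 1 ->
  (forall x, a <= x < b -> A (x, y)) -> hausdorff_measure s A != 0%E.
Proof.
move=> ab /andP[s0 s1] Aab; apply/eqP => /(hausdorff_measure0_content ltr01) A0.
have : (hausdorff_content s 1 A < ((b - a) / 2)%:E)%E.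
  by rewrite A0 lte_fin divr_gt0// subr_gt0.
move=> /content_lt_cover[U [AU U1]]; apply/negP; rewrite -leNgt.
pose r i := fine (diam (U i)).
(* The interval is centred at the projection of an arbitrary point of [U i], so its length is twice
   the diameter; hence the comparison with (b - a) / 2. *)
pose I i : set R := if pselect (exists p, U i p) is left h then
  let c := (projT1 (cid h)).1 in `[c - r i, c + r i]%classic else set0.
have rE i : U i !=set0 -> diam (U i) = (r i)%:E.
  by move=> /diam_ge0; rewrite /r; case: (diam (U i)) (U1 i).
have Ir i : (lebesgue_measure (I i) <= 2%:E * diam_pow s (U i))%E.
  rewrite /I; case: pselect => [h|_]; last first.
    by rewrite measure0 mule_ge0// diam_pow_ge0.
  have Ui : U i !=set0 by [].
  have := diam_ge0 Ui; have := U1 i; rewrite rE// !lee_fin => r1 r0.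
  rewrite /= lebesgue_measure_itv/= lte_fin; case: ifPn => [rr|_]; last first.
    by rewrite mule_ge0// diam_pow_ge0.
  rewrite -EFinB (_ : _ - _ = 2 * r i); last by ring.
  rewrite EFinM lee_pmul2l//.
  rewrite /diam_pow; case: asboolP => [U0|_]; first by move: Ui; rewrite U0 => -[].
  rewrite rE// poweR_EFin lee_fin.
  (* A diameter at most 1 does not exceed its power with exponent s < 1. *)
  by apply: ger1_powR; rewrite ?r1 ?andbT; lra.
have abI : `[a, b[%classic `<=` \bigcup_i I i.
  move=> x /=; rewrite in_itv/= => /Aab/AU[i _ Ui]; exists i => //; rewrite /I.
  case: pselect => [h|]; last by case; exists (x, y).
  case: (cid h) => -[c1 c2] /= Uc; rewrite in_itv/=.
  have := diam_ge Ui Uc; rewrite rE; last by exists (x, y).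
  rewrite lee_fin => /(le_trans (eucl_dist_fst _ _)) /=.
  by rewrite ler_norml => /andP[? ?]; apply/andP; split; lra.
have mI i : measurable (I i).
  by rewrite /I; case: pselect => //= h; exact: measurable_itv.
have h : ((b - a)%:E <= \sum_(i <oo) lebesgue_measure (I i))%E.
  have abE := @lebesgue_measure_itv R `[a, b[.
  rewrite /= lte_fin ab -EFinB in abE; rewrite -abE.
  exact: (measure_sigma_subadditive (@lebesgue_measure R) mI
    (measurable_itv `[a, b[) abI).
have {}h : ((b - a)%:E <= 2%:E * \sum_(i <oo) diam_pow s (U i))%E.
  apply: le_trans h _; rewrite -nneseriesZl; last first.
    by move=> i _; exact: diam_pow_ge0.
  by apply: lee_nneseries => [i _ _|i _].
by rewrite mulrC EFinM lee_pdivrMl.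
Qed.

End LipschitzArcs.

(** * Dyadic tilings *)

Section DyadicTiling.
Context {R : realType}.
Implicit Types (W : set (R * R)) (z m : R * R) (r : R).

Definition open_square m r : set (R * R) :=
  [set z | m.1 - r < z.1 < m.1 + r /\ m.2 - r < z.2 < m.2 + r].
Definition half_open_square m r : set (R * R) :=
  [set z | m.1 - r <= z.1 < m.1 + r /\ m.2 - r <= z.2 < m.2 + r].
Definition closed_square m r : set (R * R) :=
  [set z | m.1 - r <= z.1 <= m.1 + r /\ m.2 - r <= z.2 <= m.2 + r].

Lemma sub_open_half_open m r : open_square m r `<=` half_open_square m r.
Proof.
by move=> z [/andP[h1 h2] /andP[h3 h4]]; split; apply/andP; split => //; exact: ltW.
Qed.

Lemma sub_half_open_closed m r : half_open_square m r `<=` closed_square m r.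
Proof.
by move=> z [/andP[h1 h2] /andP[h3 h4]]; split; apply/andP; split => //; exact: ltW.
Qed.

Lemma openE2 W : open W <-> forall z, W z -> exists2 e : R, 0 < e &
  forall y, `|z.1 - y.1| < e -> `|z.2 - y.2| < e -> W y.
Proof.
rewrite openE; split=> h z Wz.
  have /nbhs_ballP[e /= e0 he] := h z Wz; exists e => // y y1 y2.
  by apply: he; split; rewrite -ball_normE.
have [e e0 he] := h z Wz; apply/nbhs_ballP; exists e => //= y.
by rewrite /ball/= /prod_ball -!ball_normE => -[] /=; exact: he.
Qed.

Definition cell_index (k : nat) z : int * int :=
  (Num.floor (2 ^+ k * z.1), Num.floor (2 ^+ k * z.2)).

Definition cell_radius (k : nat) : R := 2^-1 / 2 ^+ k.

Definition cell_center (k : nat) (c : int * int) : R * R :=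
  ((c.1%:~R + 2^-1) / 2 ^+ k, (c.2%:~R + 2^-1) / 2 ^+ k).

Lemma floor_eqP (x : R) (n : int) : Num.floor x = n <-> n%:~R <= x < n%:~R + 1.
Proof.
split=> [<-|h]; first by rewrite -[X in _ + X]/(1%:~R) -intrD floor_itv.
by apply: floor_def; rewrite intrD.
Qed.

Lemma half_open_cellE k c z :
  half_open_square (cell_center k c) (cell_radius k) z <-> cell_index k z = c.
Proof.
have k0 : 0 < 2 ^+ k :> R by rewrite exprn_gt0.
have E (n : int) (x : R) : ((n%:~R + 2^-1) / 2 ^+ k - cell_radius k <= x <
    (n%:~R + 2^-1) / 2 ^+ k + cell_radius k) = (n%:~R <= 2 ^+ k * x < n%:~R + 1).
  rewrite /cell_radius -mulrBl -mulrDl ler_pdivrMr// ltr_pdivlMr// ![x * _]mulrC.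
  by rewrite addrK -addrA (_ : 2^-1 + 2^-1 = 1 :> R)//; field.
rewrite /half_open_square/= !E /cell_index; case: c => c1 c2 /=; split.
  by move=> [/floor_eqP-> /floor_eqP->].
by move=> [/floor_eqP ? /floor_eqP ?].
Qed.

(** Dyadic cells are nested: if n is the floor of 2^(k+1) x, the floor of 2^k x is the integer a
    with 2 a <= n <= 2 a + 1, so n determines a. *)
Lemma cell_indexS k z y : cell_index k.+1 z = cell_index k.+1 y ->
  cell_index k z = cell_index k y.
Proof.
have half (x x' : R) : Num.floor (2 ^+ k.+1 * x) = Num.floor (2 ^+ k.+1 * x') ->
    Num.floor (2 ^+ k * x) = Num.floor (2 ^+ k * x').
  set n := Num.floor (2 ^+ k.+1 * x) => /esym.
  set a := Num.floor (2 ^+ k * x) => /floor_eqP; rewrite exprS -mulrA => h'.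
  have /floor_eqP := erefl n; rewrite exprS -mulrA => h.
  have /floor_eqP h1 := erefl a.
  have n1 : (2 * a <= n)%R.
    rewrite -ltzD1 -(ltr_int R) !intrD !intrM; lra.
  have n2 : (n + 1 <= 2 * a + 2)%R.
    rewrite lezD1 -(ltr_int R) !intrD !intrM; lra.
  apply/esym/floor_eqP.
  move: n1 n2; rewrite -(ler_int R) -(ler_int R) !intrD !intrM; lra.
by move=> [/half h1 /half h2]; rewrite /cell_index h1 h2.
Qed.

Lemma cell_index_le j k z y : (j <= k)%N -> cell_index k z = cell_index k y ->
  cell_index j z = cell_index j y.
Proof.
move=> /subnK <-; elim: (k - j)%N => [//|n IH]; rewrite addSn.
by move=> /cell_indexS.
Qed.

Lemma cell_radius_gt0 k : 0 < cell_radius k.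
Proof. by rewrite divr_gt0// exprn_gt0. Qed.

Lemma cell_radius_le1 k : cell_radius k <= 1.
Proof.
rewrite /cell_radius ler_pdivrMr ?exprn_gt0// mul1r.
apply: (@le_trans _ _ 1); first by rewrite invf_le1// ler1n.
by rewrite exprn_ege1// ler1n.
Qed.

Let closed_cell k z := closed_square (cell_center k (cell_index k z)) (cell_radius k).

Lemma closed_cell_small W z : open W -> W z -> exists k, closed_cell k z `<=` W.
Proof.
move=> /openE2 oW /oW[e e0 he].
have [k ke] : exists k, 2 * cell_radius k < e.
  exists (Num.truncn e^-1).+1; set N := Num.truncn _.
  rewrite /cell_radius mulrA divff// mul1r invf_plt ?posrE ?exprn_gt0//.
  apply: lt_trans (truncnS_gt _) _.
  by rewrite -natrX ltr_nat ltn_expl.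
exists k => y [y1 y2].
have /half_open_cellE[z1 z2] := erefl (cell_index k z).
by apply: he; rewrite ltr_norml; apply/andP; split; lra.
Qed.

(** The tiles are the largest dyadic cells of side at most 1 whose closure lies in [W]; by
    nestedness, two of them with a common point coincide. A tile is numbered by its code under
    [pickle], and [act] selects the codes that occur. *)
Lemma dyadic_tiling W : open W -> exists (act : nat -> Prop) (m : nat -> R * R)
    (r : nat -> R),
  [/\ forall i, act i -> 0 < r i <= 1,
      forall i, act i -> closed_square (m i) (r i) `<=` W,
      forall i j, act i -> act j -> i <> j ->
        half_open_square (m i) (r i) `&` half_open_square (m j) (r j) = set0 &
      W `<=` \bigcup_(i in act) half_open_square (m i) (r i)].
Proof.
move=> oW; pose T := (nat * (int * int))%type.
pose maxcell (t : T) := exists z, [/\ t.2 = cell_index t.1 z,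
  closed_cell t.1 z `<=` W & forall j, (j < t.1)%N -> ~ closed_cell j z `<=` W].
pose tile i : T := odflt (0%N, (0, 0)) (unpickle i).
exists (fun i => exists2 t : T, maxcell t & i = pickle t).
exists (fun i => cell_center (tile i).1 (tile i).2), (fun i => cell_radius (tile i).1).
have tileK t : tile (pickle t) = t by rewrite /tile pickleK.
split.
- by move=> i _; rewrite cell_radius_gt0 cell_radius_le1.
- by move=> _ [t [z [tz tW _]] ->]; rewrite tileK tz.
- move=> _ _ [t tmax ->] [u umax ->] tu; rewrite !tileK.
  apply/seteqP; split => // z [/half_open_cellE zt /half_open_cellE zu].
  wlog le_tu : t u tmax umax tu zt zu / (t.1 <= u.1)%N.
    move=> H; have [/H|/ltnW/H] := leqP t.1 u.1; first exact.
    by apply=> //; exact: nesym.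
  move: le_tu; rewrite leq_eqVlt => /orP[/eqP tu1|lt_tu].
    by apply: tu; congr pickle; rewrite (surjective_pairing t)
      (surjective_pairing u) -zt -zu tu1.
  (* Otherwise the coarser tile contains the point [y] that witnesses the maximality of [u], a
     contradiction. *)
  have [x [tx tW _]] := tmax; have [y [uy _ /(_ _ lt_tu)]] := umax; apply.
  rewrite /closed_cell -(cell_index_le (ltnW lt_tu) (etrans zu uy)) zt tx.
  exact: tW.
- move=> z Wz; have := closed_cell_small oW Wz.
  have ex : exists k, `[< closed_cell k z `<=` W >].
    by have [k /asboolP] := closed_cell_small oW Wz; exists k.
  case: (ex_minnP ex) => k /asboolP kW kmin.
  exists (pickle (k, cell_index k z)).
    exists (k, cell_index k z) => //; exists z; split => //= j jk /asboolP/kmin.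
    by rewrite leqNgt jk.
  by rewrite tileK; exact/half_open_cellE.
Qed.

End DyadicTiling.

(** * Regions bounded by a gauge *)

Section GaugeRegion.
Context {R : realType} (F : R * R -> R).
Context (F_homo : forall (c : R) (z : R * R), F (c *: z) = c ^+ 2 * F z).
Context (F_convex : forall (t : R) (z w : R * R), 0 <= t <= 1 ->
  F ((1 - t) *: z + t *: w) <= (1 - t) * F z + t * F w).
Context (F_ge : forall z : R * R, Num.max `|z.1| `|z.2| ^+ 2 <= F z).
Context (F_cont : continuous F).
Context (m : R * R) (r : R) (r_gt0 : 0 < r).

(** The hypotheses make [F] the square of a norm, so this is the open ball of radius [r] about [m];
    squares keep the gauge free of roots. *)
Definition gauge_region : set (R * R) := [set z | F (z - m) < r ^+ 2].
Definition gauge_curve : set (R * R) := [set z | F (z - m) = r ^+ 2].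

Let closed_region : set (R * R) := [set z | F (z - m) <= r ^+ 2].

Let Fm_cont : continuous (fun z : R * R => F (z - m)).
Proof.
move=> z; apply: (@continuous_comp _ _ _ (fun z : R * R => z - m) F); last exact: F_cont.
by apply: cvgB; [exact: cvg_id|exact: cvg_cst].
Qed.

Let F0 : F 0 = 0.
Proof. by rewrite -(scale0r (0 : R * R)) F_homo expr0n mul0r. Qed.

Let r2_gt0 : 0 < r ^+ 2.
Proof. by rewrite exprn_gt0. Qed.

Lemma gauge_region_open : open gauge_region.
Proof.
apply: (@open_comp _ _ (fun z : R * R => F (z - m)) [set x | x < r ^+ 2]).
  by move=> z _; exact: Fm_cont.
exact: open_lt.
Qed.

Let closed_region_closed : closed closed_region.
Proof.
rewrite (_ : closed_region = ~` [set z | r ^+ 2 < F (z - m)]); last first.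
  by apply/seteqP; split => z; rewrite /closed_region/= leNgt => /negP.
apply: open_closedC.
apply: (@open_comp _ _ (fun z : R * R => F (z - m)) [set x | r ^+ 2 < x]).
  by move=> z _; exact: Fm_cont.
exact: open_gt.
Qed.

Lemma gauge_lt_square z : F (z - m) < r ^+ 2 ->
  `|z.1 - m.1| < r /\ `|z.2 - m.2| < r.
Proof.
move=> /(le_lt_trans (F_ge _)); rewrite ltr_pXn2r// ?nnegrE ?(ltW r_gt0)//.
by rewrite gt_max => /andP[].
Qed.

Lemma closure_gauge_region : closure gauge_region = closed_region.
Proof.
apply/seteqP; split.
  rewrite [X in _ `<=` X](iffLR (closure_id _) closed_region_closed).
  by apply: closureS => z; exact: ltW.
move=> z; rewrite /closed_region/= le_eqVlt => /orP[/eqP zr|zr]; last first.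
  exact: subset_closure.
move=> B Bz.
(* Points of the curve are limits of points pulled towards the centre, where homogeneity makes [F]
   smaller. *)
have cf : (fun t : R => m + (1 - t) *: (z - m)) @ (0 : R) -->
    m + (1 - 0) *: (z - m).
  apply: cvgD; first exact: cvg_cst.
  apply: cvgZr_tmp.
  by apply: cvgB; [exact: cvg_cst|exact: cvg_id].
have zE : m + (1 - 0) *: (z - m) = z by rewrite subr0 scale1r addrC subrK.
rewrite zE in cf.
have /nbhs_ballP[e /= e0 he] := cf _ Bz.
pose t := Num.min (e / 2) 1.
have t0 : 0 < t by rewrite lt_min ltr01 divr_gt0.
have t1 : t <= 1 by rewrite ge_min lexx orbT.
exists (m + (1 - t) *: (z - m)); split; last first.
  apply: he; rewrite -ball_normE/= sub0r normrN gtr0_norm//.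
  by rewrite /t gt_min ltr_pdivrMr// ltr_pMr// ltr1n.
rewrite /gauge_region/= addrC addKr F_homo zr -[ltRHS]mul1r ltr_pM2r//.
by rewrite expr_lt1//; lra.
Qed.

Lemma boundary_gauge_region : boundary gauge_region = gauge_curve.
Proof.
rewrite /boundary closure_gauge_region.
rewrite (iffLR (interior_id _) gauge_region_open).
apply/seteqP; split => z /=.
  move=> [h /negP]; rewrite -leNgt => h'.
  by apply/eqP; rewrite eq_le h'; rewrite /closed_region/= in h; rewrite h.
by move=> h; split; rewrite /closed_region/gauge_region/= h ?lexx// ltxx.
Qed.

(** No Jordan curve theorem is needed. From a point outside, the ray away from [m] misses the curve
    and is unbounded. Inside, the region is relatively open and closed in the complement of the
    curve, so a component cannot leave it. *)
Lemma enclosed_gauge_curve : enclosed gauge_curve = gauge_region.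
Proof.
apply/seteqP; split => z.
  move=> [zC bz]; rewrite /gauge_region/= ltNge; apply/negP => zr.
  have {zC}zr : r ^+ 2 < F (z - m).
    by rewrite lt_neqAle zr andbT; apply/eqP => /esym.
  pose ray : set (R * R) := (fun s : R => m + s *: (z - m)) @` `[1, +oo[.
  have cray : connected ray.
    apply: connected_continuous_connected.
      exact/connected_intervalP/interval_is_interval.
    apply: continuous_subspaceT => s.
    by apply: cvgD; [exact: cvg_cst|apply: cvgZr_tmp; exact: cvg_id].
  have rayz : ray z.
    exists 1; first by rewrite /= in_itv/= lexx.
    by rewrite scale1r addrC subrK.
  have rayC : ray `<=` ~` gauge_curve.
    move=> _ [s /= + <-]; rewrite in_itv/= andbT => s1.
    rewrite /gauge_curve/= addrC addKr F_homo => E.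
    have : r ^+ 2 < r ^+ 2.
      rewrite -{2}E (lt_le_trans zr)// ler_peMl ?exprn_ege1//.
      by apply: le_trans (F_ge _); rewrite sqr_ge0.
    by rewrite ltxx.
  have sub := connected_component_max rayz rayC cray.
  have [M [Mreal HM]] := bz.
  have zm0 : 0 < `|z - m|.
    rewrite normr_gt0; apply/eqP => zm; move: zr.
    by rewrite zm F0 ltNge ltW.
  (* This point of the ray has distance more than |M| + 1 + |m| from [m], hence norm above |M| +
     1. *)
  pose s := 1 + (`|M| + 1 + `|m|) / `|z - m|.
  have s1 : 1 <= s by rewrite lerDl divr_ge0// !addr_ge0.
  have : `|m + s *: (z - m)| <= `|M| + 1.
    apply: (HM (`|M| + 1)); first by rewrite (le_lt_trans (ler_norm _))// ltrDl.
    by apply: sub; exists s => //=; rewrite in_itv/= andbT.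
  have := ler_normB (m + s *: (z - m)) m.
  rewrite [X in `|X|]addrC addKr normrZ ger0_norm; last by rewrite (le_trans ler01).
  rewrite /s mulrDl mul1r divfK ?gt_eqF// => h1 h2.
  by have := le_lt_trans h1 (_ : _ < _ + 0); lra.
move=> zr; split; first by move=> zC; move: zr; rewrite /gauge_region/= zC ltxx.
set K := connected_component _ _.
have KC : K `<=` ~` gauge_curve by exact: connected_component_sub.
have KD : K `&` gauge_region = K.
  apply: (@component_connected _ (~` gauge_curve) z).
  - exists z; split => //; apply: connected_component_refl.
    by move=> zC; move: zr; rewrite /gauge_region/= zC ltxx.
  - by exists gauge_region => //; exact: gauge_region_open.
  - exists closed_region => //.
    apply/seteqP; split => w [Kw]; first by move=> /ltW.
    rewrite /closed_region/= le_eqVlt => /orP[/eqP wC|//].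
    by have := KC _ Kw.
rewrite -KD; exists (`|m| + r); split; first exact: num_real.
move=> M hM w [_ /gauge_lt_square[w1 w2]].
apply: le_trans (ltW hM); rewrite -[w](subrK m) addrC.
apply: le_trans (ler_normD _ _) _; rewrite lerD2l.
by rewrite prod_normE/= ge_max !ltW.
Qed.

Lemma segment_gauge_region p q : gauge_curve p -> gauge_curve q ->
  segment p q `<=` closure gauge_region.
Proof.
move=> pC qC _ [t /= + <-]; rewrite in_itv/= => t01.
rewrite closure_gauge_region /closed_region/=.
have -> : (1 - t) *: p + t *: q - m = (1 - t) *: (p - m) + t *: (q - m).
  rewrite !scalerBr addrACA -opprD -scalerDl subrK scale1r.
  by [].
by apply: le_trans (F_convex _ _ t01) _; rewrite pC qC -mulrDl subrK mul1r.
Qed.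

(** On a nondegenerate segment inside the curve the midpoint would have [F] strictly below r^2. *)
Lemma gauge_strictly_convex p q :
  (forall z w : R * R, z != w -> F (2^-1 *: z + 2^-1 *: w) < 2^-1 * F z + 2^-1 * F w) ->
  segment p q `<=` gauge_curve -> p = q.
Proof.
move=> F_strict pqC; apply/eqP; apply/negPn/negP => pq.
have half : 1 - 2^-1 = 2^-1 :> R by field.
have half2 : 2^-1 + 2^-1 = 1 :> R by field.
have pC : gauge_curve p.
  by apply: pqC; exists 0; rewrite /= ?in_itv/= ?lexx ?ler01// subr0 scale1r scale0r addr0.
have qC : gauge_curve q.
  by apply: pqC; exists 1; rewrite /= ?in_itv/= ?lexx ?ler01// subrr scale1r scale0r add0r.
have : gauge_curve (2^-1 *: p + 2^-1 *: q).
  apply: pqC; exists 2^-1; last by rewrite half.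
  by rewrite /= in_itv/=; apply/andP; split; lra.
rewrite /gauge_curve/=.
have -> : 2^-1 *: p + 2^-1 *: q - m = 2^-1 *: (p - m) + 2^-1 *: (q - m).
  by rewrite !scalerBr addrACA -opprD -scalerDl half2 scale1r.
have /F_strict : p - m != q - m by rewrite (inj_eq (addIr _)).
by rewrite pC qC -mulrDl half2 mul1r => h E; move: h; rewrite E ltxx.
Qed.

End GaugeRegion.

(** * C^2 functions *)

Section TwiceContinuouslyDifferentiable.
Context {R : realType}.
Implicit Types (f g : R -> R) (t x : R).

(** Derivatives are carried as explicit functions, which turns the closure rules into computations;
    continuity of [f] and [f1] comes with their differentiability. *)
Definition C2 f := exists f1 f2 : R -> R, [/\ forall t, is_derive t 1 f (f1 t),
  forall t, is_derive t 1 f1 (f2 t) & continuous f2].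

Lemma is_derive_continuous f (d x : R) : is_derive x 1 f d -> {for x, continuous f}.
Proof. by move=> [/derivable1_diffP /differentiable_continuous]. Qed.

Lemma C2_cst (c : R) : C2 (fun=> c).
Proof.
exists (fun=> 0), (fun=> 0); split => [t|t|t]; try exact: is_derive_cst.
exact: cvg_cst.
Qed.

Lemma C2_id : C2 id.
Proof.
exists (fun=> 1), (fun=> 0); split => [t|t|t]; first exact: is_derive_id.
- exact: is_derive_cst.
- exact: cvg_cst.
Qed.

Lemma C2D f g : C2 f -> C2 g -> C2 (fun t => f t + g t).
Proof.
move=> [f1 [f2 [hf hf1 hf2]]] [g1 [g2 [hg hg1 hg2]]].
exists (fun t => f1 t + g1 t), (fun t => f2 t + g2 t); split => [t|t|t].
- exact: is_deriveD.
- exact: is_deriveD.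
- by apply: cvgD; [exact: hf2|exact: hg2].
Qed.

Lemma is_derive_mul f g t (df dg : R) : is_derive t 1 f df -> is_derive t 1 g dg ->
  is_derive t 1 (fun s => f s * g s) (f t * dg + g t * df).
Proof. by move=> hf hg; have := is_deriveM hf hg. Qed.

Lemma is_derive_scale (c : R) f t (df : R) : is_derive t 1 f df ->
  is_derive t 1 (fun s => c * f s) (c * df).
Proof. by move=> hf; have := is_deriveZ c hf. Qed.

Lemma C2M f g : C2 f -> C2 g -> C2 (fun t => f t * g t).
Proof.
move=> [f1 [f2 [hf hf1 hf2]]] [g1 [g2 [hg hg1 hg2]]].
exists (fun t => f t * g1 t + g t * f1 t).
exists (fun t => (f t * g2 t + g1 t * f1 t) + (g t * f2 t + f1 t * g1 t)).
have cf t := is_derive_continuous (hf t); have cf1 t := is_derive_continuous (hf1 t).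
have cg t := is_derive_continuous (hg t); have cg1 t := is_derive_continuous (hg1 t).
split => [t|t|t].
- exact: is_derive_mul (hf t) (hg t).
- exact: is_deriveD (is_derive_mul (hf t) (hg1 t)) (is_derive_mul (hg t) (hf1 t)).
- exact: cvgD (cvgD (cvgM (cf t) (hg2 t)) (cvgM (cg1 t) (cf1 t)))
    (cvgD (cvgM (cg t) (hf2 t)) (cvgM (cf1 t) (cg1 t))).
Qed.

(** The predicate [P] admits outer functions that are smooth only on part of the line, such as real
    powers on the positive numbers. *)
Lemma C2_comp (P : R -> Prop) (phi phi1 phi2 : R -> R) f :
  (forall x, P x -> is_derive x 1 phi (phi1 x)) ->
  (forall x, P x -> is_derive x 1 phi1 (phi2 x)) ->
  (forall x, P x -> {for x, continuous phi2}) ->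
  C2 f -> (forall t, P (f t)) -> C2 (fun t => phi (f t)).
Proof.
move=> h h1 h2 [f1 [f2 [hf hf1 hf2]]] Pf.
exists (fun t => phi1 (f t) * f1 t).
exists (fun t => phi1 (f t) * f2 t + f1 t * (phi2 (f t) * f1 t)).
have cf t := is_derive_continuous (hf t); have cf1 t := is_derive_continuous (hf1 t).
have cphi1 t : {for t, continuous (fun t => phi1 (f t))}.
  by apply: continuous_comp; [exact: cf|exact: (is_derive_continuous (h1 _ (Pf t)))].
have cphi2 t : {for t, continuous (fun t => phi2 (f t))}.
  by apply: continuous_comp; [exact: cf|exact: h2].
split => [t|t|t].
- exact: (@is_derive1_comp _ phi f t _ _ (h _ (Pf t)) (hf t)).
- exact: (is_derive_mul (@is_derive1_comp _ phi1 f t _ _ (h1 _ (Pf t)) (hf t)) (hf1 t)).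
- exact: cvgD (cvgM (cphi1 t) (hf2 t)) (cvgM (cf1 t) (cvgM (cphi2 t) (cf1 t))).
Qed.

Lemma C2_cos f : C2 f -> C2 (fun t => cos (f t)).
Proof.
move=> hf; apply: (@C2_comp (fun=> True) cos (fun x => - sin x) (fun x => - cos x)) => //.
by move=> x _; apply: cvgN; exact: continuous_cos.
Qed.

Lemma C2_sin f : C2 f -> C2 (fun t => sin (f t)).
Proof.
move=> hf; apply: (@C2_comp (fun=> True) sin cos (fun x => - sin x)) => //.
by move=> x _; apply: cvgN; exact: continuous_sin.
Qed.

Lemma C2_powR (a : R) f : C2 f -> (forall t, 0 < f t) -> C2 (fun t => f t `^ a).
Proof.
move=> hf f0; apply: (@C2_comp (fun x => 0 < x) (fun x => x `^ a)
  (fun x => a * x `^ (a - 1)) (fun x => a * ((a - 1) * x `^ (a - 1 - 1)))) => //.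
- by move=> x x0; exact: is_derive_scale (is_derive1_powR (a - 1) x0).
- move=> x x0; apply: cvgM; first exact: cvg_cst.
  apply: cvgM; first exact: cvg_cst.
  exact: (is_derive_continuous (is_derive1_powR (a - 1 - 1) x0)).
Qed.

(** Away from 0 the function is plus or minus z^2; at 0 its difference quotient is |z|, which tends
    to 0. *)
Lemma is_derive_mulr_norm x : is_derive x 1 (fun z : R => z * `|z|) (2 * `|x|).
Proof.
have [x0|x0|->] := ltgtP x 0.
- apply: (@near_eq_is_derive _ _ _ (fun z : R => - (z * z))).
    near=> z; rewrite ltr0_norm ?mulrN//; near: z.
    exact: (@open_lt _ 0).
  apply: (@is_derive_eq _ _ _ (fun z : R => - (z * z)) x 1 (2 * `|x|) (- (x * 1 + x * 1))).
  by rewrite ltr0_norm//; ring.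
- apply: (@near_eq_is_derive _ _ _ (fun z : R => z * z)).
    near=> z; rewrite gtr0_norm//; near: z.
    exact: (@open_gt _ 0).
  apply: (@is_derive_eq _ _ _ (fun z : R => z * z) x 1 (2 * `|x|) (x * 1 + x * 1)).
  by rewrite gtr0_norm//; ring.
- apply/is_derive1_caratheodory; exists Num.norm; split.
  + by move=> z; rewrite mul0r !subr0 mulrC.
  + exact: norm_continuous.
  + by rewrite normr0 mulr0.
Unshelve. all: by end_near. Qed.

(** Written as x (x |x|), the cube of |x| has second derivative 6 |x|, still continuous at 0. It is
    the building block of the smoothing. *)
Lemma C2_norm_cube f : C2 f -> C2 (fun t => `|f t| ^+ 3).
Proof.
move=> hf; have -> : (fun t => `|f t| ^+ 3) = (fun t => f t * (f t * `|f t|)).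
  by apply/funext => t; rewrite mulrA -expr2 -real_normK ?num_real// -exprSr.
apply: (@C2_comp (fun=> True) (fun x => x * (x * `|x|)) (fun x => 3 * (x * `|x|))
  (fun x => 3 * (2 * `|x|))) => //.
- move=> x _; apply: (@is_derive_eq _ _ _ _ _ _ _
    (x * (2 * `|x|) + (x * `|x|) * 1)); last by ring.
  exact: is_derive_mul (is_derive_id x 1) (is_derive_mulr_norm x).
- by move=> x _; exact: is_derive_scale (is_derive_mulr_norm x).
- move=> x _; apply: cvgM; first exact: cvg_cst.
  by apply: cvgM; [exact: cvg_cst|exact: norm_continuous].
Qed.

Lemma is_derive_pair f g t (f' g' : R) : is_derive t 1 f f' -> is_derive t 1 g g' ->
  is_derive t 1 (fun s => (f s, g s)) (f', g').
Proof.
move=> [df fE] [dg gE].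
have cfg : (fun h : R => h^-1 *: (((fun s => (f s, g s)) \o shift t) (h *: 1) -
    (f t, g t))) @ 0^' --> (f', g').
  have h := cvg_pair (df : _ --> _) (dg : _ --> _).
  by rewrite -fE -gE; exact: h.
split; first by apply/cvg_ex; exists (f', g').
exact: (cvg_lim _ cfg).
Qed.

Lemma C2_lipschitz f : C2 f -> exists2 K : R, 0 <= K &
  forall x y, 0 <= x <= 1 -> 0 <= y <= 1 -> `|f x - f y| <= K * `|x - y|.
Proof.
move=> [f1 [f2 [hf hf1 _]]].
have cf t := is_derive_continuous (hf t); have cf1 t := is_derive_continuous (hf1 t).
have [c _ hc] : exists2 c, c \in `[0, 1]%R &
    forall t, t \in `[0, 1]%R -> `|f1 t| <= `|f1 c|.
  apply: (@EVT_max _ (fun t => `|f1 t|) 0 1 ler01).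
  apply: continuous_subspaceT => t.
  by apply: continuous_comp; [exact: cf1|exact: norm_continuous].
exists `|f1 c| => // x y.
wlog xy : x y / x <= y.
  move=> H hx hy; have [/H|/ltW/H] := leP x y; first exact.
  by rewrite distrC [X in _ * X]distrC; exact.
move=> /andP[x0 x1] /andP[y0 y1].
have [z zxy] := @MVT_segment _ f f1 x y xy (fun t _ => hf t) (continuous_subspaceT cf).
move: zxy; rewrite in_itv/= => /andP[xz zy] fxy.
rewrite distrC fxy normrM [X in _ * X]distrC ler_wpM2r// hc// in_itv/=.
by rewrite (le_trans x0 xz) (le_trans zy y1).
Qed.

End TwiceContinuouslyDifferentiable.

(** * Parametrization of gauge curves *)

Section GaugeCurveParametrization.
Context {R : realType}.

Definition circle_point (t : R) : R * R := (cos (pi *+ 2 * t), sin (pi *+ 2 * t)).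

Let twopi_gt0 : 0 < pi *+ 2 :> R.
Proof. by rewrite mulrn_wgt0// pi_gt0. Qed.

Lemma circle_point_sqr t : (circle_point t).1 ^+ 2 + (circle_point t).2 ^+ 2 = 1.
Proof. exact: cos2Dsin2. Qed.

Lemma circle_pointD1 t : circle_point (t + 1) = circle_point t.
Proof. by rewrite /circle_point mulrDr mulr1 cosD2pi sinD2pi. Qed.

Lemma circle_point_surj (x y : R) : x ^+ 2 + y ^+ 2 = 1 ->
  exists t, circle_point t = (x, y).
Proof.
move=> xy1.
have x1 : -1 <= x <= 1.
  by rewrite -ler_norml -(@ler_pXn2r _ 2)// ?nnegrE// expr1n real_normK ?num_real//;
    rewrite -xy1 lerDl sqr_ge0.
have yE : Num.sqrt (1 - x ^+ 2) = `|y| by rewrite -xy1 addrC addKr sqrtr_sqr.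
have ax : -1 <= x <= 1 -> cos (acos x) = x by move=> h; apply: acosK; rewrite in_itv.
have [y0|y0] := leP 0 y.
  exists (acos x / (pi *+ 2)).
  rewrite /circle_point mulrC divfK ?gt_eqF// ax// sin_acos// yE ger0_norm//.
exists (- acos x / (pi *+ 2)).
rewrite /circle_point mulrC divfK ?gt_eqF// cosN sinN ax// sin_acos// yE.
by rewrite ltr0_norm// opprK.
Qed.

Lemma circle_point_inj : {in `[0, 1[ &, injective circle_point}.
Proof.
have main (x y : R) : 0 <= x -> x < y -> y < 1 -> circle_point x <> circle_point y.
  move=> x0 xy y1 [ec es].
  have : cos (pi *+ 2 * y - pi *+ 2 * x) = 1.
    by rewrite cosB ec es -!expr2 cos2Dsin2.
  (* By the double angle formula, the cosine of twice an angle in (0, pi) is below 1. *)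
  have -> : pi *+ 2 * y - pi *+ 2 * x = (pi * (y - x)) *+ 2 by ring.
  rewrite cos_mulr2n cos2sin2.
  have : 0 < sin (pi * (y - x)).
    apply: sin_gt0_pi; rewrite mulr_gt0 ?pi_gt0 ?subr_gt0//=.
    by rewrite -[ltRHS]mulr1 ltr_pM2l ?pi_gt0//; lra.
  by move=> s0; have := exprn_gt0 2 s0; lra.
move=> x y; rewrite !in_itv/= => /andP[x0 x1] /andP[y0 y1] exy.
have [xy|yx|//] := ltgtP x y; first by have := main x y x0 xy y1 exy.
by have := main y x y0 yx x1 (esym exy).
Qed.

Context (F : R * R -> R).
Context (F_homo : forall (c : R) (z : R * R), F (c *: z) = c ^+ 2 * F z).
Context (F_ge : forall z : R * R, Num.max `|z.1| `|z.2| ^+ 2 <= F z).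
Context (F_C2 : C2 (fun t => F (circle_point t))).
Context (m : R * R) (r : R) (r_gt0 : 0 < r).

Let F_circle_gt0 t : 0 < F (circle_point t).
Proof.
apply: lt_le_trans (F_ge _); rewrite exprn_gt0// lt_max !normr_gt0 -negb_and.
apply/negP => /andP[/eqP c0 /eqP s0].
by have := circle_point_sqr t; rewrite c0 s0 !expr0n addr0 => /eqP; rewrite eq_sym oner_eq0.
Qed.

(** Polar equation of the curve: by homogeneity the ray from [m] in the unit direction u meets it at
    distance r / sqrt(F u). *)
Definition gauge_radius t := r * F (circle_point t) `^ (- 2^-1).

Definition gauge_param t : R * R := m + gauge_radius t *: circle_point t.

Let radius_gt0 t : 0 < gauge_radius t.
Proof. by rewrite mulr_gt0// powR_gt0. Qed.

Let radius_sqr t : gauge_radius t ^+ 2 * F (circle_point t) = r ^+ 2.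
Proof.
rewrite /gauge_radius exprMn -[X in _ * X * _]powR_mulrn ?powR_ge0//.
rewrite -powRrM mulNr mulVf ?pnatr_eq0// powR_inv1 ?(ltW (F_circle_gt0 _))//.
by rewrite divfK ?gt_eqF.
Qed.

Let C2_radius : C2 gauge_radius.
Proof. by apply: C2M; [exact: C2_cst|exact: C2_powR]. Qed.

Let C2_angle : C2 (fun t : R => pi *+ 2 * t).
Proof. by apply: C2M; [exact: C2_cst|exact: C2_id]. Qed.

Lemma gauge_curveE : gauge_curve F m r = range gauge_param.
Proof.
apply/seteqP; split => [z zr|_ [t _ <-]]; last first.
  by rewrite /gauge_curve/= /gauge_param addrC addKr F_homo radius_sqr.
pose n := Num.sqrt ((z - m).1 ^+ 2 + (z - m).2 ^+ 2).
have n2 : n ^+ 2 = (z - m).1 ^+ 2 + (z - m).2 ^+ 2.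
  by rewrite sqr_sqrtr// addr_ge0// sqr_ge0.
have n0 : n != 0.
  apply/eqP => n0; move: n2; rewrite n0 expr0n => /esym/eqP.
  rewrite paddr_eq0 ?sqr_ge0// !sqrf_eq0 => /andP[/eqP z1 /eqP z2].
  have z0 : z - m = 0 *: (z - m).
    by rewrite scale0r [LHS]surjective_pairing z1 z2.
  move: zr; rewrite /gauge_curve/= z0 F_homo expr0n mul0r => /esym/eqP.
  by rewrite sqrf_eq0 gt_eqF.
have [|t tE] := @circle_point_surj ((z - m).1 / n) ((z - m).2 / n).
  by rewrite !expr_div_n -mulrDl -n2 divff// sqrf_eq0.
have zE : z - m = n *: circle_point t.
  rewrite tE [LHS]surjective_pairing; congr pair => /=;
  by rewrite /GRing.scale/= mulrC divfK.
exists t => //; rewrite /gauge_param.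
have -> : gauge_radius t = n.
  apply/eqP; rewrite -(@eqrXn2 _ 2)// ?(ltW (radius_gt0 _)) ?sqrtr_ge0//.
  rewrite -(inj_eq (mulIf (lt0r_neq0 (F_circle_gt0 t)))) radius_sqr.
  by rewrite -F_homo -zE zr.
by rewrite -zE addrC subrK.
Qed.

Let param_pair : gauge_param = (fun t => (m.1 + gauge_radius t * cos (pi *+ 2 * t),
   m.2 + gauge_radius t * sin (pi *+ 2 * t))).
Proof. by []. Qed.

Let C2_param1 : C2 (fun t => m.1 + gauge_radius t * cos (pi *+ 2 * t)).
Proof.
by apply: C2D; [exact: C2_cst|apply: C2M; [exact: C2_radius|exact: C2_cos C2_angle]].
Qed.

Let C2_param2 : C2 (fun t => m.2 + gauge_radius t * sin (pi *+ 2 * t)).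
Proof.
by apply: C2D; [exact: C2_cst|apply: C2M; [exact: C2_radius|exact: C2_sin C2_angle]].
Qed.

(** For injectivity, the distance from [m] gives back the radius, and then the direction gives back
    the parameter. *)
Lemma gauge_jordan_param : jordan_param gauge_param.
Proof.
split.
- move=> t; rewrite param_pair.
  have [f1 [_ [/(_ t)/is_derive_continuous h1 _ _]]] := C2_param1.
  have [f2 [_ [/(_ t)/is_derive_continuous h2 _ _]]] := C2_param2.
  exact: cvg_pair h1 h2.
- by move=> t; rewrite /gauge_param /gauge_radius circle_pointD1.
- move=> t s t01 s01 /addrI ts.
  have rts : gauge_radius t = gauge_radius s.
    have sqr x : (gauge_radius x *: circle_point x).1 ^+ 2 +
        (gauge_radius x *: circle_point x).2 ^+ 2 = gauge_radius x ^+ 2.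
      rewrite /= /GRing.scale/= !exprMn -mulrDr.
      by have := circle_point_sqr x => /= ->; rewrite mulr1.
    apply/eqP; rewrite -(@eqrXn2 _ 2)// ?(ltW (radius_gt0 _))//.
    by rewrite -!sqr ts.
  apply: circle_point_inj => //.
  apply: (@scalerI _ _ (gauge_radius t)); first by rewrite gt_eqF.
  by rewrite ts rts.
Qed.

Lemma gauge_jordan_curve : jordan_curve (gauge_curve F m r).
Proof. by exists gauge_param; [exact: gauge_jordan_param|exact: gauge_curveE]. Qed.

(* The derivative does not vanish: its component along the rotated unit vector
   [(- sin, cos)] is [2 pi] times the radius. *)
Lemma gauge_smooth_curve : smooth_curve (gauge_curve F m r).
Proof.
exists gauge_param.
have [rd [_ [hr _ _]]] := C2_radius.
have [f1 [f2 [hf hf1 hf2]]] := C2_param1.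
have [g1 [g2 [hg hg1 hg2]]] := C2_param2.
have d1 (t : R) : is_derive t 1 gauge_param (f1 t, g1 t).
  by rewrite param_pair; exact: is_derive_pair.
have d1E : derive1 gauge_param = (fun t => (f1 t, g1 t)).
  by apply/funext => t; rewrite derive1E; have [] := d1 t.
have d2 (t : R) : is_derive t 1 (derive1 gauge_param) (f2 t, g2 t).
  by rewrite d1E; exact: is_derive_pair.
have d2E : derive1n 2 gauge_param = (fun t => (f2 t, g2 t)).
  apply/funext => t; rewrite derive1nS derive1n1 derive1E.
  by have [] := d2 t.
split.
- exact: gauge_jordan_param.
- exact: gauge_curveE.
- by move=> t; split; [have [] := d1 t|have [] := d2 t].
- by rewrite d2E => t; exact: cvg_pair (hf2 t) (hg2 t).
- move=> t; rewrite d1E; apply/eqP => -[f10 g10].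
  have hangle : is_derive t 1 (fun t : R => pi *+ 2 * t) (pi *+ 2 * 1).
    exact: is_derive_scale (is_derive_id t 1).
  have hc : is_derive t 1 (fun t : R => cos (pi *+ 2 * t))
      (- sin (pi *+ 2 * t) * (pi *+ 2 * 1)).
    exact: (@is_derive1_comp _ cos (fun t : R => pi *+ 2 * t) t _ _
      (is_derive_cos _) hangle).
  have hs : is_derive t 1 (fun t : R => sin (pi *+ 2 * t))
      (cos (pi *+ 2 * t) * (pi *+ 2 * 1)).
    exact: (@is_derive1_comp _ sin (fun t : R => pi *+ 2 * t) t _ _
      (is_derive_sin _) hangle).
  have hx := is_deriveD (is_derive_cst m.1 t 1) (is_derive_mul (hr t) hc).
  have hy := is_deriveD (is_derive_cst m.2 t 1) (is_derive_mul (hr t) hs).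
  have xE := etrans (esym (@derive_val _ _ _ _ _ _ _ hx))
    (@derive_val _ _ _ _ _ _ _ (hf t)).
  have yE := etrans (esym (@derive_val _ _ _ _ _ _ _ hy))
    (@derive_val _ _ _ _ _ _ _ (hg t)).
  rewrite f10 add0r in xE; rewrite g10 add0r in yE.
  have := cos2Dsin2 (pi *+ 2 * t) => cs1.
  have : gauge_radius t * (pi *+ 2) = 0.
    rewrite -[LHS]mulr1 -cs1.
    rewrite -[RHS](_ : 0 * cos (pi *+ 2 * t) - 0 * sin (pi *+ 2 * t) = 0); last first.
      by rewrite !mul0r subr0.
    by rewrite -{1}yE -xE; ring.
  by apply/eqP; rewrite mulf_neq0// gt_eqF.
Qed.

Lemma gauge_lipschitz_arc : lipschitz_arc (gauge_curve F m r).
Proof.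
have [K K0 hK] := C2_lipschitz C2_param1.
have [L L0 hL] := C2_lipschitz C2_param2.
exists gauge_param, (K + L + 1); split.
- by rewrite ltr_wpDl// addr_ge0.
- move=> x y x01 y01; apply: le_trans (eucl_dist_le_add _ _) _.
  rewrite mulrDl mul1r -[leLHS]addr0 lerD// mulrDl.
  by apply: lerD; [exact: hK|exact: hL].
- rewrite gauge_curveE => _ [t _ <-].
  exists (t - (Num.floor t)%:~R).
    have /andP[t0 t1] := floor_itv t.
    by rewrite /= in_itv/= subr_ge0 t0/= lerBlDl ltW// -[X in _ + X]/(1%:~R) -intrD.
  have per n : gauge_param (t - n%:~R) = gauge_param t.
    have pnat k u : gauge_param (u + k%:R) = gauge_param u.
      elim: k u => [|k IH] u; first by rewrite addr0.
      by rewrite -natr1 addrA /gauge_param /gauge_radius circle_pointD1; exact: IH.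
    case: n => k; first by rewrite -(pnat k (t - k%:R)) subrK.
    by rewrite NegzE mulrNz opprK; exact: pnat.
  exact: per.
Qed.

End GaugeCurveParametrization.

(** * The smoothed square *)

Section SmoothedSquare.
Context {R : realType}.
Implicit Types (a b e k p x y : R) (z w : R * R).

(* [b * chi (a / b)], where [chi] is the second difference of [|x|^3 / 6]: a C^2
   convex function that equals [|x|] for [|x| >= 1]. *)
Definition soft_abs a b : R :=
  (`|a + b| ^+ 3 - 2 * `|a| ^+ 3 + `|a - b| ^+ 3) / (6 * b ^+ 2).

Lemma soft_absN a b : soft_abs (- a) b = soft_abs a b.
Proof.
rewrite /soft_abs normrN; congr (_ / _).
by rewrite -[`|- a - b|]normrN opprD !opprK -[`|- a + b|]normrN opprD opprK; ring.
Qed.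

Lemma soft_abs_norm a b : soft_abs `|a| b = soft_abs a b.
Proof.
have [a0|a0] := leP 0 a; first by rewrite ger0_norm.
by rewrite ltr0_norm// soft_absN.
Qed.

Lemma soft_abs_outer a b : 0 < b -> b <= `|a| -> soft_abs a b = `|a|.
Proof.
rewrite -soft_abs_norm; move: `|a| => {}a b0 ba; rewrite /soft_abs.
rewrite !ger0_norm ?subr_ge0//; try lra.
by field; rewrite gt_eqF.
Qed.

Lemma soft_abs_inner a b : 0 < b -> `|a| <= b ->
  soft_abs a b = b / 3 + `|a| ^+ 2 / b - `|a| ^+ 3 / (3 * b ^+ 2).
Proof.
rewrite -soft_abs_norm; have := normr_ge0 a; move: `|a| => {}a a0 b0 ab.
rewrite /soft_abs [`|a - b|]ler0_norm ?subr_le0// !ger0_norm//; last lra.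
by field; rewrite gt_eqF.
Qed.

(* [soft_abs] is the supremum of these forms: the slopes and intercepts of its
   tangents at [p = |a| / b]. *)
Lemma soft_abs_ge_tangent a b p : 0 < b -> 0 <= p <= 1 ->
  (2 * p - p ^+ 2) * `|a| + (1 - p) ^+ 2 * (1 + 2 * p) / 3 * b <= soft_abs a b.
Proof.
move=> b0 /andP[p0 p1]; have [ab|/ltW ba] := leP `|a| b.
  rewrite soft_abs_inner// -subr_ge0; have := normr_ge0 a.
  move: `|a| ab => {}a ab a0.
  (* Scaled to b = 1, the difference between the cubic and its tangent at p has p as a double root;
     the remaining factor 3 - q - 2 p is nonnegative as p, q <= 1. *)
  pose q := a / b; have aE : a = q * b by rewrite divfK// gt_eqF.
  have q0 : 0 <= q by rewrite divr_ge0// ltW.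
  have q1 : q <= 1 by rewrite ler_pdivrMr// mul1r.
  rewrite (_ : _ - _ = b * ((p - q) ^+ 2 * (3 - q - 2 * p) / 3)); last first.
    by rewrite aE; field; rewrite gt_eqF.
  rewrite mulr_ge0 ?(ltW b0)// divr_ge0// mulr_ge0 ?sqr_ge0//; lra.
rewrite soft_abs_outer//; move: `|a| ba => {}a ba.
have h1 : 0 <= (1 - p) ^+ 2 * (1 + 2 * p) / 3.
  by rewrite divr_ge0// mulr_ge0 ?sqr_ge0//; lra.
have h2 : (1 - p) ^+ 2 * (1 + 2 * p) / 3 * b <= (1 - p) ^+ 2 * (1 + 2 * p) / 3 * a.
  by rewrite ler_wpM2l.
apply: (@le_trans _ _ ((2 * p - p ^+ 2) * a + (1 - p) ^+ 2 * (1 + 2 * p) / 3 * a)).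
  by rewrite lerD2l.
rewrite -subr_ge0 (_ : _ - _ = a * ((1 - p) ^+ 2 * (2 - 2 * p) / 3)); last by field.
rewrite mulr_ge0//; first by rewrite (le_trans (ltW b0)).
by rewrite divr_ge0// mulr_ge0 ?sqr_ge0//; lra.
Qed.

(** The supremum is attained: at p = |a| / b when |a| <= b, and at p = 1 beyond. *)
Lemma soft_abs_tangent a b : 0 < b -> exists2 p, 0 <= p <= 1 &
  soft_abs a b = (2 * p - p ^+ 2) * `|a| + (1 - p) ^+ 2 * (1 + 2 * p) / 3 * b.
Proof.
move=> b0; have [ab|/ltW ba] := leP `|a| b; last first.
  exists 1; rewrite ?ler01 ?lexx// soft_abs_outer//; ring.
exists (`|a| / b); last first.
  by rewrite soft_abs_inner//; field; rewrite gt_eqF.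
by rewrite divr_ge0 ?(ltW b0)//= ler_pdivrMr// mul1r.
Qed.

(** Tangent slopes are at most 1 and intercepts at most b / 3, the value of [soft_abs] at 0. *)
Lemma soft_abs_le a b : 0 < b -> soft_abs a b <= `|a| + b / 3.
Proof.
move=> b0; have [p /andP[p0 p1] ->] := soft_abs_tangent a b0.
apply: lerD.
  by rewrite ler_piMl//; have := sqr_ge0 (1 - p); rewrite sqrrB expr1n mul1r mulr2n; lra.
rewrite -mulrA [3^-1 * b]mulrC ler_piMl//; first by rewrite divr_ge0// ltW.
rewrite -subr_ge0 (_ : _ - _ = p ^+ 2 * (3 - 2 * p)); last by ring.
by rewrite mulr_ge0 ?sqr_ge0//; lra.
Qed.

Lemma soft_absZ (c : R) a b : 0 <= c -> soft_abs (c * a) (c * b) = c * soft_abs a b.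
Proof.
move=> c0; rewrite /soft_abs -mulrDr -mulrBr !normrM (ger0_norm c0) !exprMn.
have [->|cN0] := eqVneq c 0; first by rewrite !(mul0r, expr0n)/= !mulr0 invr0 !mulr0.
have [->|bN0] := eqVneq b 0; first by rewrite expr0n/= !mulr0 invr0 !mulr0.
by field; rewrite bN0 cN0.
Qed.

Context (e k : R) (e_gt0 : 0 < e) (e_le1 : e <= 1) (k_ge0 : 0 <= k).

(* For [e = k = 0] this would be the square of the max norm. *)
Definition smooth_square_gauge z : R :=
  (2^-1 + k) * (z.1 ^+ 2 + z.2 ^+ 2) +
  soft_abs (z.1 ^+ 2 - z.2 ^+ 2) (e * (z.1 ^+ 2 + z.2 ^+ 2)) / 2.

Local Notation F := smooth_square_gauge.

Lemma smooth_square_homo (c : R) z : F (c *: z) = c ^+ 2 * F z.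
Proof.
rewrite /F/= /GRing.scale/= !exprMn -mulrBr -mulrDr [e * _]mulrCA soft_absZ ?sqr_ge0//.
by ring.
Qed.

Lemma smooth_square0 : F 0 = 0.
Proof. by rewrite -(scale0r (0 : R * R)) smooth_square_homo expr0n mul0r. Qed.

Lemma sqr_norm_gt0 z : z != 0 -> 0 < z.1 ^+ 2 + z.2 ^+ 2.
Proof.
move=> z0; rewrite lt_neqAle addr_ge0 ?sqr_ge0// andbT eq_sym.
rewrite paddr_eq0 ?sqr_ge0// !sqrf_eq0; apply: contra z0 => /andP[/eqP z1 /eqP z2].
by rewrite [z]surjective_pairing z1 z2.
Qed.

(** Each tangent of [soft_abs] bounds the gauge below by multiples of x^2 + y^2 and |x^2 - y^2|.
    Replacing the absolute value by the signed difference that is right at [z] leaves a quadratic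
    form touching at [z]. Convexity and continuity of the gauge are read off from these forms. *)
Lemma smooth_square_support z : exists A B : R,
  [/\ k <= A <= k + 2, k <= B <= k + 2, F z = A * z.1 ^+ 2 + B * z.2 ^+ 2 &
     forall w, A * w.1 ^+ 2 + B * w.2 ^+ 2 <= F w].
Proof.
have [z0|z0] := eqVneq z 0.
  (* At the origin every form below the gauge touches it. *)
  exists (k + 2^-1), (k + 2^-1); split; try by apply/andP; split; lra.
    by rewrite z0 smooth_square0 /= expr0n mulr0 addr0.
  move=> w; have [->|w0] := eqVneq w 0.
    by rewrite smooth_square0 /= expr0n mulr0 addr0.
  have ew : 0 < e * (w.1 ^+ 2 + w.2 ^+ 2) by rewrite mulr_gt0// sqr_norm_gt0.
  have := @soft_abs_ge_tangent (w.1 ^+ 2 - w.2 ^+ 2) _ 1 ew.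
  rewrite ler01 lexx => /(_ isT); rewrite /F.
  by have := normr_ge0 (w.1 ^+ 2 - w.2 ^+ 2); lra.
have ez : 0 < e * (z.1 ^+ 2 + z.2 ^+ 2) by rewrite mulr_gt0// sqr_norm_gt0.
have [p p01 zp] := soft_abs_tangent (z.1 ^+ 2 - z.2 ^+ 2) ez.
have /andP[p0 p1] := p01.
(* Half the slope, and half the intercept times [e]. The bound M <= 1/2 keeps the smaller
   coefficient 1/2 + k + c - M at least k. *)
pose M := (2 * p - p ^+ 2) / 2; pose c := (1 - p) ^+ 2 * (1 + 2 * p) / 3 * e / 2.
have M01 : 0 <= M <= 2^-1.
  by rewrite /M; have := sqr_ge0 (1 - p); have := mulr_ge0 p0 (_ : 0 <= 1 - p);
    rewrite sqrrB expr1n mul1r mulr2n subr_ge0 mulrBr mulr1 -expr2 => /(_ p1) ? ?;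
    apply/andP; split; lra.
have c01 : 0 <= c <= 1.
  have h1 : 0 <= (1 - p) ^+ 2 * (1 + 2 * p).
    by rewrite mulr_ge0 ?sqr_ge0//; lra.
  have h2 : (1 - p) ^+ 2 * (1 + 2 * p) <= 1.
    rewrite -subr_ge0 (_ : _ - _ = p ^+ 2 * (3 - 2 * p)); last by ring.
    by rewrite mulr_ge0 ?sqr_ge0//; lra.
  have h3 : (1 - p) ^+ 2 * (1 + 2 * p) * e <= 1.
    by apply: mulr_ile1 => //; rewrite ltW.
  have h4 : 0 <= (1 - p) ^+ 2 * (1 + 2 * p) * e by rewrite mulr_ge0// ltW.
  rewrite /c (_ : _ / 2 = (1 - p) ^+ 2 * (1 + 2 * p) * e / 6); last by field.
  by apply/andP; split; lra.
have /andP[M0 M1] := M01; have /andP[c0 c1] := c01.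
have low w : (2^-1 + k + c) * (w.1 ^+ 2 + w.2 ^+ 2) + M * `|w.1 ^+ 2 - w.2 ^+ 2| <= F w.
  have [->|w0] := eqVneq w 0.
    by rewrite smooth_square0 /= expr0n/= !addr0 subr0 normr0 !mulr0 addr0.
  have ew : 0 < e * (w.1 ^+ 2 + w.2 ^+ 2) by rewrite mulr_gt0// sqr_norm_gt0.
  have := @soft_abs_ge_tangent (w.1 ^+ 2 - w.2 ^+ 2) _ p ew p01.
  by rewrite /F /M /c; lra.
have Fz : F z = (2^-1 + k + c) * (z.1 ^+ 2 + z.2 ^+ 2) + M * `|z.1 ^+ 2 - z.2 ^+ 2|.
  by rewrite /F zp /M /c; ring.
have [d0|/ltW d0] := leP 0 (z.1 ^+ 2 - z.2 ^+ 2).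
  exists (2^-1 + k + c + M), (2^-1 + k + c - M); split; try by apply/andP; split; lra.
    by rewrite Fz ger0_norm//; ring.
  move=> w; apply: le_trans (low w).
  have := ler_wpM2l M0 (ler_norm (w.1 ^+ 2 - w.2 ^+ 2)); lra.
exists (2^-1 + k + c - M), (2^-1 + k + c + M); split; try by apply/andP; split; lra.
  by rewrite Fz ler0_norm//; ring.
move=> w; apply: le_trans (low w).
have := ler_wpM2l M0 (ler_norm (- (w.1 ^+ 2 - w.2 ^+ 2))); rewrite normrN; lra.
Qed.

Lemma smooth_square_convex (t : R) z w : 0 <= t <= 1 ->
  F ((1 - t) *: z + t *: w) <= (1 - t) * F z + t * F w.
Proof.
move=> /andP[t0 t1].
have [A [B [/andP[A0 _] /andP[B0 _] -> AB]]] :=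
  smooth_square_support ((1 - t) *: z + t *: w).
have sq (x y : R) : ((1 - t) * x + t * y) ^+ 2 <= (1 - t) * x ^+ 2 + t * y ^+ 2.
  rewrite -subr_ge0 (_ : _ - _ = t * (1 - t) * (x - y) ^+ 2); last by ring.
  by rewrite mulr_ge0 ?sqr_ge0// mulr_ge0// subr_ge0.
apply: (@le_trans _ _ ((1 - t) * (A * z.1 ^+ 2 + B * z.2 ^+ 2) +
    t * (A * w.1 ^+ 2 + B * w.2 ^+ 2))); last first.
  by apply: lerD; rewrite ler_wpM2l ?AB// subr_ge0.
have h1 := ler_wpM2l (le_trans k_ge0 A0) (sq z.1 w.1).
have h2 := ler_wpM2l (le_trans k_ge0 B0) (sq z.2 w.2).
rewrite /= /GRing.scale/=; lra.
Qed.

(** The form supporting the gauge at the midpoint has coefficients at least k > 0, so it is positive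
    definite and the parallelogram identity makes the inequality strict. *)
Lemma smooth_square_strictly_convex z w : 0 < k -> z != w ->
  F (2^-1 *: z + 2^-1 *: w) < 2^-1 * F z + 2^-1 * F w.
Proof.
move=> k0 zw.
have [A [B [/andP[A0 _] /andP[B0 _] -> AB]]] :=
  smooth_square_support (2^-1 *: z + 2^-1 *: w).
apply: (@lt_le_trans _ _ (2^-1 * (A * z.1 ^+ 2 + B * z.2 ^+ 2) +
    2^-1 * (A * w.1 ^+ 2 + B * w.2 ^+ 2))); last first.
  by apply: lerD; rewrite ler_wpM2l ?AB.
have := @sqr_norm_gt0 (z - w); rewrite subr_eq0 => /(_ zw) /= zw0.
rewrite -subr_gt0 (_ : _ - _ =
  4^-1 * (A * (z.1 - w.1) ^+ 2 + B * (z.2 - w.2) ^+ 2)); last first.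
  by rewrite /= /GRing.scale/=; field.
rewrite mulr_gt0//.
have h1 := ler_wpM2r (sqr_ge0 (z.1 - w.1)) A0.
have h2 := ler_wpM2r (sqr_ge0 (z.2 - w.2)) B0.
have := mulr_gt0 k0 zw0; rewrite mulrDr; lra.
Qed.

(** The tangent at p = 1 says that [soft_abs] dominates the absolute value. *)
Lemma smooth_square_ge z : Num.max `|z.1| `|z.2| ^+ 2 <= F z.
Proof.
have [->|z0] := eqVneq z 0.
  by rewrite smooth_square0 /= normr0 maxxx expr0n.
have ez : 0 < e * (z.1 ^+ 2 + z.2 ^+ 2) by rewrite mulr_gt0// sqr_norm_gt0.
have := @soft_abs_ge_tangent (z.1 ^+ 2 - z.2 ^+ 2) _ 1 ez.
rewrite ler01 lexx => /(_ isT) h.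
have h1 := ler_norm (z.1 ^+ 2 - z.2 ^+ 2).
have := ler_norm (- (z.1 ^+ 2 - z.2 ^+ 2)); rewrite normrN => h2.
have h3 := mulr_ge0 k_ge0 (ltW (sqr_norm_gt0 z0)).
rewrite /F; have [_|_] := leP `|z.1| `|z.2|; rewrite real_normK ?num_real//; lra.
Qed.

(** F z - F w is at most the same difference for the form that supports F at z, whose coefficients
    are at most k + 2; exchanging z and w bounds the absolute value. *)
Lemma smooth_square_continuous : continuous F.
Proof.
have dist z w : `|F z - F w| <=
    (k + 2) * (`|z.1 ^+ 2 - w.1 ^+ 2| + `|z.2 ^+ 2 - w.2 ^+ 2|).
  have le z' w' : F z' - F w' <=
      (k + 2) * (`|z'.1 ^+ 2 - w'.1 ^+ 2| + `|z'.2 ^+ 2 - w'.2 ^+ 2|).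
    have [A [B [/andP[A0 A2] /andP[B0 B2] -> /(_ w') AB]]] := smooth_square_support z'.
    apply: (@le_trans _ _ (A * (z'.1 ^+ 2 - w'.1 ^+ 2) + B * (z'.2 ^+ 2 - w'.2 ^+ 2))).
      lra.
    rewrite [leRHS]mulrDr; apply: lerD; (apply: le_trans (ler_wpM2l _ (ler_norm _)) _;
      [exact: le_trans k_ge0 _|exact: ler_wpM2r]).
  rewrite ler_norml; apply/andP; split; last exact: le.
  rewrite lerNl opprB; apply: le_trans (le w z) _.
  by rewrite [X in _ * (X + _)]distrC [X in _ * (_ + X)]distrC.
move=> z; apply/cvgrPdist_le => d d0.
have cz : (fun w : R * R => (k + 2) * (`|z.1 ^+ 2 - w.1 ^+ 2| +
    `|z.2 ^+ 2 - w.2 ^+ 2|)) @ z --> (k + 2) * (`|z.1 ^+ 2 - z.1 ^+ 2| +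
    `|z.2 ^+ 2 - z.2 ^+ 2|).
  apply: cvgM; first exact: cvg_cst.
  apply: cvgD; apply: cvg_norm; (apply: cvgB; first exact: cvg_cst).
    have h : (fun w : R * R => w.1) @ z --> z.1 by exact: cvg_fst.
    exact: (cvgM h h).
  have h : (fun w : R * R => w.2) @ z --> z.2 by exact: cvg_snd.
  exact: (cvgM h h).
rewrite !subrr !normr0 addr0 mulr0 in cz.
near=> w; apply: le_trans (dist _ _) _; apply/ltW; near: w.
exact: (cvgr_lt _ cz).
Unshelve. all: by end_near. Qed.

Lemma smooth_square_C2 : C2 (fun t => F (circle_point t)).
Proof.
pose f (t : R) := cos (pi *+ 2 * t) ^+ 2 - sin (pi *+ 2 * t) ^+ 2.
have -> : (fun t => F (circle_point t)) = (fun t => (2^-1 + k) +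
    (`|f t + e| ^+ 3 + -2 * `|f t| ^+ 3 + `|f t + - e| ^+ 3) * ((6 * e ^+ 2)^-1 / 2)).
  apply/funext => t; rewrite /F circle_point_sqr !mulr1 /soft_abs -/(f t).
  by field; rewrite gt_eqF.
have Ca : C2 (fun t : R => pi *+ 2 * t) by apply: C2M; [exact: C2_cst|exact: C2_id].
have Cf : C2 f.
  have -> : f = (fun t => cos (pi *+ 2 * t) * cos (pi *+ 2 * t) +
      -1 * (sin (pi *+ 2 * t) * sin (pi *+ 2 * t))).
    by apply/funext => t; rewrite mulN1r.
  apply: C2D; first exact: C2M (C2_cos Ca) (C2_cos Ca).
  exact: C2M (C2_cst _) (C2M (C2_sin Ca) (C2_sin Ca)).
apply: C2D; first exact: C2_cst.
apply: C2M; last exact: C2_cst.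
apply: C2D; last by apply: C2_norm_cube; exact: C2D Cf (C2_cst _).
apply: C2D; first by apply: C2_norm_cube; exact: C2D Cf (C2_cst _).
exact: C2M (C2_cst _) (C2_norm_cube Cf).
Qed.

(** A tile minus its smooth region, normalized to centre 0 and radius 1. *)
Definition square_gap : set (R * R) :=
  [set z | [/\ `|z.1| < 1, `|z.2| < 1 & 1 <= F z]].

(** By [soft_abs_le] the gauge exceeds max(x^2, y^2) by at most 2 k + e / 3 on the square, so the
    gap is a thin ring along its sides. *)
Lemma square_gap_max z : square_gap z ->
  1 - 2 * k - e <= z.1 ^+ 2 \/ 1 - 2 * k - e <= z.2 ^+ 2.
Proof.
move=> [z1 z2 Fz].
have sq (x : R) : `|x| < 1 -> x ^+ 2 <= 1.
  by move=> x1; rewrite -real_normK ?num_real// expr_le1// ltW.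
have [z0|z0] := eqVneq z 0; first by rewrite z0 smooth_square0 in Fz; lra.
have ez : 0 < e * (z.1 ^+ 2 + z.2 ^+ 2) by rewrite mulr_gt0// sqr_norm_gt0.
have h := soft_abs_le (z.1 ^+ 2 - z.2 ^+ 2) ez; rewrite /F in Fz.
have z12 : z.1 ^+ 2 + z.2 ^+ 2 <= 2 by have := sq _ z1; have := sq _ z2; lra.
have hk : k * (z.1 ^+ 2 + z.2 ^+ 2) <= k * 2 by rewrite ler_wpM2l.
have he : e * (z.1 ^+ 2 + z.2 ^+ 2) <= e * 2 by rewrite ler_wpM2l ?(ltW e_gt0).
have [d0|/ltW d0] := leP 0 (z.1 ^+ 2 - z.2 ^+ 2).
  by left; rewrite ger0_norm// in h; lra.
by right; rewrite ler0_norm// in h; lra.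
Qed.

(** Off the cone |x^2 - y^2| < e (x^2 + y^2) the gauge with k = 0 is exactly max(x^2, y^2), which is
    below 1. So gap points lie in the cone, where the two squares differ by less than 2 e, and only
    the corners remain. *)
Lemma square_gap_min z : k = 0 -> square_gap z ->
  1 - 3 * e <= z.1 ^+ 2 /\ 1 - 3 * e <= z.2 ^+ 2.
Proof.
move=> k0 gz; have := square_gap_max gz; move: gz => [z1 z2 Fz].
have sq (x : R) : `|x| < 1 -> x ^+ 2 < 1.
  by move=> x1; rewrite -real_normK ?num_real// expr_lt1.
have [z0|z0] := eqVneq z 0; first by rewrite z0 smooth_square0 in Fz; lra.
have ez : 0 < e * (z.1 ^+ 2 + z.2 ^+ 2) by rewrite mulr_gt0// sqr_norm_gt0.
have he : e * (z.1 ^+ 2 + z.2 ^+ 2) <= e * 2.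
  by rewrite ler_wpM2l ?(ltW e_gt0)//; have := sq _ z1; have := sq _ z2; lra.
have [h|h] := leP (e * (z.1 ^+ 2 + z.2 ^+ 2)) `|z.1 ^+ 2 - z.2 ^+ 2|.
  rewrite /F soft_abs_outer// k0 in Fz; exfalso.
  have := sq _ z1; have := sq _ z2.
  have [d0|/ltW d0] := leP 0 (z.1 ^+ 2 - z.2 ^+ 2).
    by rewrite ger0_norm// in Fz; lra.
  by rewrite ler0_norm// in Fz; lra.
move: h; rewrite ltr_norml k0 => /andP[h1 h2]; rewrite mulr0 subr0.
by move=> [?|?]; split; lra.
Qed.

End SmoothedSquare.

(** * Covers of the gap between a square and its smoothing *)

Section GapContent.
Context {R : realType}.
Implicit Types (e k s x : R) (U : set (R * R)).

Lemma box_diam_le U (a b d : R) : 0 <= d ->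
  (forall z, U z -> a <= z.1 <= a + d /\ b <= z.2 <= b + d) ->
  (diam U <= (2 * d)%:E)%E.
Proof.
move=> d0 Uab; apply: diam_le => p q /Uab[/andP[p1 p2] /andP[p3 p4]].
move=> /Uab[/andP[q1 q2] /andP[q3 q4]].
apply: le_trans (eucl_dist_le_add _ _) _.
have h1 : `|p.1 - q.1| <= d by rewrite ler_norml; apply/andP; split; lra.
have h2 : `|p.2 - q.2| <= d by rewrite ler_norml; apply/andP; split; lra.
lra.
Qed.

Lemma sqr_le_norm x : `|x| < 1 -> x ^+ 2 <= `|x|.
Proof.
by move=> x1; rewrite -real_normK ?num_real// expr2 ler_piMr// ltW.
Qed.

Lemma corner_gap_content (eps : R) : 0 < eps -> exists2 e, 0 < e <= 1 &
  (hausdorff_content 1 eps (square_gap e 0) <= eps%:E)%E.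
Proof.
move=> eps0; pose e := Num.min 1 (eps / 24).
have e0 : 0 < e by rewrite lt_min ltr01 divr_gt0.
have e1 : e <= 1 by rewrite ge_min lexx.
have e2 : 24 * e <= eps by rewrite -ler_pdivlMl// mulrC ge_min lexx orbT.
exists e; first by rewrite e0.
pose side (b : bool) x := if b then 1 - 3 * e <= x <= 1 else - 1 <= x <= -1 + 3 * e.
have sideP x : `|x| < 1 -> 1 - 3 * e <= x ^+ 2 -> side (0 <= x) x.
  move=> x1 /le_trans/(_ (sqr_le_norm x1)) h; rewrite /side.
  by move: x1 h; case: (ger0P x) => x0 x1 h; apply/andP; split; lra.
apply: le_trans (@content_finite_cover _ 1 eps (2 * (3 * e)) _ 4
  (fun i => [set z | side (odd i) z.1 /\ side (odd i./2) z.2]) _ _ _ _) _ => //.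
- by apply/andP; split; lra.
- move=> z gz; have [h1 h2] := square_gap_min e0 (lexx 0) erefl gz.
  case: gz => z1 z2 _.
  have := sideP _ z1 h1; have := sideP _ z2 h2.
  case: (0 <= z.1); case: (0 <= z.2) => sy sx.
  + by exists 3%N.
  + by exists 1%N.
  + by exists 2%N.
  + by exists 0%N.
- move=> i _; apply: (@box_diam_le _ (if odd i then 1 - 3 * e else -1)
    (if odd i./2 then 1 - 3 * e else -1)); first lra.
  move=> z /= []; rewrite /side; case: (odd i); case: (odd i./2) => h1 h2;
  by rewrite ?subrK.
- by rewrite lee_fin powRr1; lra.
Qed.

Lemma ring_gap_content s (eps : R) : 1 < s -> 0 < eps -> exists2 e, 0 < e <= 1 &
  (hausdorff_content s eps (square_gap e e) <= eps%:E)%E.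
Proof.
move=> s1 eps0.
have [eta eta0 heta] : exists2 d : R, 0 < d &
    forall x : R, 0 <= x <= d -> x `^ (s - 1) <= eps / 16.
  by apply: powR_small; rewrite ?subr_gt0// divr_gt0.
have [N] : exists N, 2 / N.+1%:R <= Num.min eps eta.
  by apply: inv_nat_small; rewrite lt_min eps0.
rewrite le_min => /andP[Neps Neta].
pose M : R := N.+1%:R; have M0 : 0 < M by [].
have M1 : 1 <= M by rewrite ler1n.
pose h := M^-1; have h0 : 0 < h by rewrite invr_gt0.
have hM : h * M = 1 by rewrite mulVf// gt_eqF.
have h1 : h <= 1 by rewrite invf_le1.
exists (h / 3); first by apply/andP; split; lra.
(* The ring consists of four strips of width [h], each cut into [2 / h] boxes. *)
pose side (b : bool) x := if b then 1 - h <= x <= 1 else - 1 <= x <= -1 + h.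
have sideP x : `|x| < 1 -> 1 - h <= x ^+ 2 -> side (0 <= x) x.
  move=> x1 /le_trans/(_ (sqr_le_norm x1)) h'; rewrite /side.
  by move: x1 h'; case: (ger0P x) => x0 x1 h'; apply/andP; split; lra.
pose strip (j : nat) x := -1 + j%:R * h <= x <= -1 + j%:R * h + h.
have stripP x : `|x| < 1 -> exists2 j, (j < 2 * N.+1)%N & strip j x.
  rewrite ltr_norml => /andP[x1 x2].
  have xM : 0 <= (x + 1) * M by rewrite mulr_ge0//; lra.
  exists (Num.truncn ((x + 1) * M)).
    rewrite truncn_lt_nat// natrM ltr_pM2r//; lra.
  have := truncn_itv xM; rewrite -natr1 => /andP[t1 t2].
  have := ler_wpM2l (ltW h0) t1; have := ler_wpM2l (ltW h0) (ltW t2).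
  rewrite [h * ((x + 1) * M)]mulrCA hM mulr1 mulrDr mulr1 => u1 u2.
  by rewrite /strip; apply/andP; split; lra.
pose U i : set (R * R) := let j := (i %/ 4)%N in
  if odd (i %% 4)./2 then [set z | side (odd (i %% 4)) z.1 /\ strip j z.2]
  else [set z | strip j z.1 /\ side (odd (i %% 4)) z.2].
have UE (b c : bool) j : U (j * 4 + (b.*2 + c))%N =
    if b then [set z | side c z.1 /\ strip j z.2]
    else [set z | strip j z.1 /\ side c z.2].
  rewrite /U divnMDl// modnMDl.
  have bc : (b.*2 + c < 4)%N by case: b; case: c.
  by rewrite divn_small// modn_small// addn0; case: b bc; case: c.
apply: le_trans (@content_finite_cover _ s eps (2 * h) _ (2 * N.+1 * 4) U _ _ _ _) _.
- lra.
- by rewrite mulr_ge0 ?(ltW h0).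
- move=> z gz; have e0 : 0 < h / 3 by lra.
  have := square_gap_max e0 (ltW e0) gz; case: gz => z1 z2 _.
  have idx (b c : bool) j : (j < 2 * N.+1)%N -> (j * 4 + (b.*2 + c) < 2 * N.+1 * 4)%N.
    move=> jN; have bc : (b.*2 + c < 4)%N by case: b; case: c.
    apply: (@leq_trans (j.+1 * 4)); last by rewrite leq_pmul2r.
    by rewrite mulSn addnC ltn_add2r.
  case=> zh.
    have [j jN jz] := stripP _ z2.
    exists (j * 4 + (true.*2 + (0 <= z.1)%R))%N; first exact: idx.
    by rewrite UE; split=> //; apply: sideP => //; lra.
  have [j jN jz] := stripP _ z1.
  exists (j * 4 + (false.*2 + (0 <= z.2)%R))%N; first exact: idx.
  by rewrite UE; split=> //; apply: sideP => //; lra.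
- move=> i _; pose sd (b : bool) : R := if b then 1 - h else -1.
  have sdE b x : side b x -> sd b <= x <= sd b + h.
    by rewrite /side /sd; case: b => //; rewrite subrK.
  rewrite /U; case: (odd (i %% 4)./2).
    apply: (@box_diam_le _ (sd (odd (i %% 4))) (-1 + (i %/ 4)%:R * h)); first exact: ltW.
    by move=> z /= [/sdE].
  apply: (@box_diam_le _ (-1 + (i %/ 4)%:R * h) (sd (odd (i %% 4)))); first exact: ltW.
  by move=> z /= [? /sdE].
- rewrite lee_fin.
  have h20 : 0 <= 2 * h by rewrite mulr_ge0 ?(ltW h0).
  rewrite -(mulr_powRB1 h20); last lra.
  rewrite (_ : (2 * N.+1 * 4)%:R = 8 * M); last by rewrite !natrM -/M; ring.
  have inv16 (u v : R) : v * u = 1 -> 8 * u * (2 * v) = 16.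
    have -> : 8 * u * (2 * v) = 16 * (v * u) by ring.
    by move->; rewrite mulr1.
  rewrite mulrA (inv16 _ _ hM).
  rewrite mulrC -ler_pdivlMr//; apply: heta.
  by rewrite h20.
Qed.

End GapContent.

(** * The packing *)

Section PackingLevel.
Context {R : realType}.
Implicit Types (W : set (R * R)) (m z : R * R) (r e k : R).

Lemma lipschitz_arc_subset (A B : set (R * R)) : A `<=` B ->
  lipschitz_arc B -> lipschitz_arc A.
Proof.
by move=> AB [f [K [K0 fK Bf]]]; exists f, K; split => //; exact: subset_trans Bf.
Qed.

Lemma lipschitz_arc_vsegment (a b r : R) : 0 < r ->
  lipschitz_arc [set z : R * R | z.1 = a /\ b - r <= z.2 <= b + r].
Proof.
move=> r0; exists (fun t => (a, b - r + 2 * r * t)), (2 * r); split.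
- by rewrite mulr_gt0.
- move=> x y _ _; apply: le_trans (eucl_dist_le_add _ _) _ => /=.
  rewrite subrr normr0 add0r opprD addrACA subrr add0r -mulrBr normrM.
  by rewrite ger0_norm ?mulr_ge0 ?(ltW r0).
- move=> [x y] /= [-> /andP[y1 y2]].
  have r2 : 0 < 2 * r by rewrite mulr_gt0.
  exists ((y - (b - r)) / (2 * r)).
    by rewrite /= in_itv/= ler_pdivlMr// ler_pdivrMr//; apply/andP; split; lra.
  by congr pair; rewrite mulrC divfK ?gt_eqF// addrC subrK.
Qed.

Lemma lipschitz_arc_hsegment (a b r : R) : 0 < r ->
  lipschitz_arc [set z : R * R | z.2 = b /\ a - r <= z.1 <= a + r].
Proof.
move=> r0; exists (fun t => (a - r + 2 * r * t, b)), (2 * r); split.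
- by rewrite mulr_gt0.
- move=> x y _ _; apply: le_trans (eucl_dist_le_add _ _) _ => /=.
  rewrite subrr normr0 addr0 opprD addrACA subrr add0r -mulrBr normrM.
  by rewrite ger0_norm ?mulr_ge0 ?(ltW r0).
- move=> [x y] /= [-> /andP[y1 y2]].
  have r2 : 0 < 2 * r by rewrite mulr_gt0.
  exists ((x - (a - r)) / (2 * r)).
    by rewrite /= in_itv/= ler_pdivlMr// ler_pdivrMr//; apply/andP; split; lra.
  by congr pair; rewrite mulrC divfK ?gt_eqF// addrC subrK.
Qed.

Lemma lipschitz_arc_set0 : lipschitz_arc (set0 : set (R * R)).
Proof. exact: lipschitz_arc_subset (lipschitz_arc_vsegment 0 0 ltr01). Qed.

Definition smooth_square e k m r := gauge_region (smooth_square_gauge e k) m r.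

Lemma open_square_open m r : open (open_square m r).
Proof.
apply/openE2 => z [/andP[a1 a2] /andP[b1 b2]].
exists (Num.min (Num.min (z.1 - (m.1 - r)) (m.1 + r - z.1))
                (Num.min (z.2 - (m.2 - r)) (m.2 + r - z.2))).
  by rewrite !lt_min; apply/andP; split; apply/andP; split; lra.
move=> y; rewrite !lt_min => /andP[/andP[c1 c2] _] /andP[_ /andP[d1 d2]].
move: c1 c2 d1 d2; rewrite !ltr_norml.
move=> /andP[c1 c2] /andP[c3 c4] /andP[d1 d2] /andP[d3 d4].
by split; apply/andP; split; lra.
Qed.

Lemma smooth_square_sub_open e k m r : 0 < e -> 0 <= k -> 0 < r ->
  smooth_square e k m r `<=` open_square m r.
Proof.
move=> e0 k0 r0 z /(gauge_lt_square (smooth_square_ge e0 k0) r0)[].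
rewrite !ltr_norml => /andP[a1 a2] /andP[b1 b2].
by split; apply/andP; split; lra.
Qed.

Lemma closure_smooth_square e k m r : 0 < e -> e <= 1 -> 0 <= k -> 0 < r ->
  closure (smooth_square e k m r) =
  [set z | smooth_square_gauge e k (z - m) <= r ^+ 2].
Proof.
move=> e0 e1 k0 r0; apply: closure_gauge_region => //.
- exact: smooth_square_homo.
- exact: smooth_square_continuous.
Qed.

Lemma tile_gap_nonempty e k m r : 0 < e -> e <= 1 -> 0 <= k -> 0 < r ->
  open_square m r `\` closure (smooth_square e k m r) !=set0.
Proof.
move=> e0 e1 k0 r0; rewrite closure_smooth_square//.
pose t : R := 1 - e / 12; have t0 : 0 < t by rewrite /t; lra.
have t1 : t < 1 by rewrite /t; lra.
exists (m + (r * t) *: (1, 1)); split.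
  have rt : 0 < r * t by rewrite mulr_gt0.
  have rt1 : r * t < r by rewrite -[ltRHS]mulr1 ltr_pM2l.
  by rewrite /open_square/= /GRing.scale/= mulr1; split; apply/andP; split; lra.
rewrite /= addrC addKr smooth_square_homo exprMn; apply/negP; rewrite -ltNge.
rewrite -mulrA -[ltLHS]mulr1 ltr_pM2l ?exprn_gt0//.
have -> : smooth_square_gauge e k (1, 1) = 1 + 2 * k + e / 3.
  rewrite /smooth_square_gauge/= expr1n subrr soft_abs_inner; last 2 first.
  - by rewrite mulr_gt0.
  - by rewrite normr0 mulr_ge0// ltW.
  by rewrite normr0 !expr0n/= !mul0r addr0 subr0; field.
apply: (@lt_le_trans _ _ (t ^+ 2 * (1 + e / 3))); last first.
  by rewrite ler_wpM2l ?sqr_ge0//; lra.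
have h1 : 1 - e / 6 <= t ^+ 2.
  by rewrite -subr_ge0 (_ : _ - _ = (e / 12) ^+ 2) ?sqr_ge0// /t; field.
have h2 : e * e <= e by rewrite ler_piMl// ltW.
apply: (@lt_le_trans _ _ ((1 - e / 6) * (1 + e / 3))).
  rewrite -subr_gt0 (_ : _ - _ = e / 6 - e * e / 18); last by field.
  lra.
by rewrite ler_wpM2r//; lra.
Qed.

Lemma tile_gap_content (s : R) eps delta e k m r : 0 < s -> eps <= 1 ->
  eps <= delta -> 0 < e -> e <= 1 -> 0 <= k -> 0 < r -> r <= 1 ->
  (hausdorff_content s eps (square_gap e k) <= eps%:E)%E ->
  (hausdorff_content s delta (open_square m r `\` closure (smooth_square e k m r))
     <= eps%:E)%E.
Proof.
move=> s0 eps1 epsd e0 e1 k0 r0 r1 h.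
apply: le_trans h.
apply: (@le_trans _ _ (hausdorff_content s delta (square_gap e k))); last first.
  by apply: le_content => //; rewrite s0 lexx.
apply: (@le_trans _ _ (hausdorff_content s delta
    ((fun z : R * R => m + r *: z) @` square_gap e k))); last first.
  apply: content_contraction => [|p q]; first exact: ltW.
  rewrite /eucl_dist; apply: ler_wsqrtr => /=; rewrite /GRing.scale/=.
  have -> (a x y : R) : a + r * x - (a + r * y) = r * (x - y) by ring.
  have -> (a x y : R) : a + r * x - (a + r * y) = r * (x - y) by ring.
  rewrite !exprMn -mulrDr ler_piMl ?addr_ge0 ?sqr_ge0//.
  by rewrite expr_le1// ltW.
apply: content_subset => z [[/andP[a1 a2] /andP[b1 b2]]].
rewrite closure_smooth_square//= => /negP; rewrite -ltNge => rz.
have zE : z - m = r *: (r^-1 *: (z - m)).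
  by rewrite scalerA divff ?gt_eqF// scale1r.
exists (r^-1 *: (z - m)); last by rewrite -zE addrC subrK.
split.
- rewrite /= /GRing.scale/= normrM gtr0_norm ?invr_gt0// ltr_pdivrMl// mulr1.
  by rewrite ltr_norml; apply/andP; split; lra.
- rewrite /= /GRing.scale/= normrM gtr0_norm ?invr_gt0// ltr_pdivrMl// mulr1.
  by rewrite ltr_norml; apply/andP; split; lra.
- move: rz; rewrite {1}zE smooth_square_homo -[ltLHS]mulr1.
  by rewrite ltr_pM2l ?exprn_gt0// => /ltW.
Qed.

Record packing_level (good : R -> Prop) (s eps : R) W (act : nat -> Prop)
    (D : nat -> set (R * R)) (A : nat -> nat -> set (R * R)) W' : Prop := {
  level_shape : forall i, act i -> exists e k m r,
    [/\ 0 < e, e <= 1, 0 <= k & 0 < r] /\ good k /\ D i = smooth_square e k m r;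
  level_sub : forall i, act i -> D i `<=` W;
  level_disjoint : forall i j, act i -> act j -> i <> j -> D i `&` D j = set0;
  level_open : open W';
  level_next_sub : W' `<=` W;
  level_next_disjoint : forall i, act i -> W' `&` D i = set0;
  level_arc : forall i j, lipschitz_arc (A i j);
  level_cover : W `<=` W' `|` (\bigcup_(i in act) D i `|` \bigcup_i \bigcup_j A i j);
  level_content : (hausdorff_content s eps W' <= eps%:E)%E;
  level_next_nonempty : W' !=set0;
  level_active : exists i, act i;
  level_segment : exists a b y : R, a < b /\ forall x, a <= x < b ->
    [/\ W (x, y), ~ W' (x, y) & forall i, act i -> ~ D i (x, y)] }.

Lemma packing_level_exists (good : R -> Prop) (s eps : R) W :
  0 < s -> 0 < eps -> eps <= 1 ->
  (forall eps, 0 < eps -> exists e k,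
     [/\ 0 < e, e <= 1, 0 <= k & good k] /\
     (hausdorff_content s eps (square_gap e k) <= eps%:E)%E) ->
  open W -> W !=set0 ->
  exists act D A W', packing_level good s eps W act D A W'.
Proof.
move=> s0 eps0 eps1 shape oW W0.
have [act [m [r [r01 QW Qdisj WQ]]]] := dyadic_tiling oW.
pose eps_ i := eps / (2 ^ i.+1)%:R.
have eps_0 i : 0 < eps_ i by rewrite divr_gt0// ltr0n expn_gt0.
have eps_le i : eps_ i <= eps.
  rewrite ler_pdivrMr ?ltr0n ?expn_gt0// ler_peMr ?(ltW eps0)// ler1n.
  by rewrite expn_gt0.
have /choice[ek ekP] : forall i, exists ek : R * R,
    [/\ 0 < ek.1, ek.1 <= 1, 0 <= ek.2 & good ek.2] /\
    (hausdorff_content s (eps_ i) (square_gap ek.1 ek.2) <= (eps_ i)%:E)%E.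
  by move=> i; have [e [k h]] := shape _ (eps_0 i); exists (e, k).
pose D i := smooth_square (ek i).1 (ek i).2 (m i) (r i).
pose G i := open_square (m i) (r i) `\` closure (D i).
have r0 i : act i -> 0 < r i by move=> /r01/andP[].
have r1 i : act i -> r i <= 1 by move=> /r01/andP[].
have DQ i : act i -> D i `<=` open_square (m i) (r i).
  by move=> ai; have [[? ? ? ?] _] := ekP i; apply: smooth_square_sub_open => //; exact: r0.
have QQ i j z : act i -> act j -> half_open_square (m i) (r i) z ->
    half_open_square (m j) (r j) z -> i = j.
  move=> ai aj zi zj; apply: contrapT => ij.
  by have : set0 z by rewrite -(Qdisj i j ai aj ij).
have oWE i : act i -> open_square (m i) (r i) `<=` W.
  move=> ai z /sub_open_half_open/sub_half_open_closed; exact: QW.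
have [i0 ai0] : exists i, act i by case: W0 => z /WQ[i ai _]; exists i.
pose A i (j : nat) : set (R * R) := if `[< act i >] then
  match j with
  | 0 => [set z | z.1 = (m i).1 - r i /\ (m i).2 - r i <= z.2 <= (m i).2 + r i]
  | 1 => [set z | z.2 = (m i).2 - r i /\ (m i).1 - r i <= z.1 <= (m i).1 + r i]
  | _ => gauge_curve (smooth_square_gauge (ek i).1 (ek i).2) (m i) (r i)
  end else set0.
exists act, D, A, (\bigcup_(i in act) G i); split.
- move=> i ai; have [[e0 e1 k0 gk] _] := ekP i.
  by exists (ek i).1, (ek i).2, (m i), (r i); split => //; split => //; exact: r0.
- by move=> i ai; apply: subset_trans (DQ i ai) _; exact: oWE.
- move=> i j ai aj ij; apply/seteqP; split => // z [zi zj].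
  by apply: ij; apply: (QQ i j z) => //; apply: sub_open_half_open; exact: DQ.
- apply: bigcup_open => i ai; apply: openI; first exact: open_square_open.
  by apply: closed_openC; exact: closed_closure.
- by move=> z [i ai [zi _]]; exact: (oWE i).
- move=> i ai; apply/seteqP; split => // z [[j aj [zj zDj]] zDi].
  have ij : i = j.
    apply: (QQ i j z) => //; apply: sub_open_half_open => //; exact: DQ.
  by apply: zDj; rewrite -ij; exact: subset_closure.
- move=> i j; rewrite /A; case: asboolP => [ai|_]; last exact: lipschitz_arc_set0.
  have ri := r0 i ai; have [[e0 e1 k0 _] _] := ekP i.
  case: j => [|[|j]].
  + exact: lipschitz_arc_vsegment.
  + exact: lipschitz_arc_hsegment.
  + apply: gauge_lipschitz_arc => //; [exact: smooth_square_homo|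
      exact: smooth_square_ge|exact: smooth_square_C2].
- move=> z Wz; have [i ai zi] := WQ z Wz.
  have zc := sub_half_open_closed zi.
  have [zo|zno] := pselect (open_square (m i) (r i) z); last first.
    right; right; exists i => //.
    case: zc zi => zc1 zc2 [/andP[h1 h2] /andP[h3 h4]].
    have [z1|z1] := eqVneq z.1 ((m i).1 - r i).
      by exists 0%N => //; rewrite /A; case: asboolP.
    have [z2|z2] := eqVneq z.2 ((m i).2 - r i).
      by exists 1%N => //; rewrite /A; case: asboolP.
    case: zno; split; rewrite ?h2 ?h4 andbT lt_neqAle eq_sym.
      by rewrite z1.
    by rewrite z2.
  have [zcl|zncl] := pselect (closure (D i) z); last by left; exists i.
  have [zD|zD] := pselect (D i z); first by right; left; exists i.
  right; right; exists i => //; exists 2 => //; rewrite /A; case: asboolP => // _.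
  have [[e0 e1 k0 _] _] := ekP i.
  rewrite /D closure_smooth_square//= in zcl; last exact: r0.
  apply/eqP; rewrite eq_le zcl/= leNgt; exact/negP.
- apply: le_trans (epsilon_trick0 xpredT (ltW eps0)).
  rewrite bigcup_mkcond; apply: le_trans (content_bigcup _ _ _) _.
  apply: lee_nneseries => [i _ _|i _]; first exact: content_ge0.
  case: ifPn => [|_]; last first.
    apply: (@le_trans _ _ 0%E); last by rewrite lee_fin; exact: ltW (eps_0 i).
    have := @content_finite_cover _ s eps 0 set0 0 (fun=> set0) (ltW s0).
    by rewrite mul0r lexx (ltW eps0); apply.
  rewrite inE => ai; have [[e0 e1 k0 _] hc] := ekP i.
  exact: (tile_gap_content (m i) s0 (le_trans (eps_le i) eps1) (eps_le i)
    e0 e1 k0 (r0 i ai) (r1 i ai) hc).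
- have [[e0 e1 k0 _] _] := ekP i0.
  have [z zG] := tile_gap_nonempty (m i0) e0 e1 k0 (r0 _ ai0).
  by exists z; exists i0.
- by exists i0.
- exists ((m i0).1 - r i0), ((m i0).1 + r i0), ((m i0).2 - r i0).
  have r00 := r0 _ ai0; split; first lra.
  move=> x xi.
  have xh : half_open_square (m i0) (r i0) (x, (m i0).2 - r i0).
    by split => //=; apply/andP; split; lra.
  have nopen j : act j -> ~ open_square (m j) (r j) (x, (m i0).2 - r i0).
    move=> aj xj; have E := QQ j i0 _ aj ai0 (sub_open_half_open xj) xh.
    by move: xj; rewrite E => -[_ /=]; rewrite ltxx.
  split.
  + by apply: (QW i0 ai0); exact: sub_half_open_closed.
  + by move=> [j aj [xj _]]; exact: (nopen j).
  + by move=> j aj /(DQ j aj); exact: nopen.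
Qed.

End PackingLevel.

Section PackingConstruction.
Context {R : realType}.
Implicit Types (A S W Omega : set (R * R)) (e k r : R) (m : R * R).

Section SmoothSquareShape.
Context (e k r : R) (m : R * R).
Context (e_gt0 : 0 < e) (e_le1 : e <= 1) (k_ge0 : 0 <= k) (r_gt0 : 0 < r).

Let F := smooth_square_gauge e k.
Let F_homo : forall (c : R) (z : R * R), F (c *: z) = c ^+ 2 * F z.
Proof. exact: smooth_square_homo. Qed.
Let F_convex : forall (t : R) (z w : R * R), 0 <= t <= 1 ->
  F ((1 - t) *: z + t *: w) <= (1 - t) * F z + t * F w.
Proof. by move=> *; exact: smooth_square_convex. Qed.
Let F_ge : forall z : R * R, Num.max `|z.1| `|z.2| ^+ 2 <= F z.
Proof. exact: smooth_square_ge. Qed.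
Let F_cont : continuous F.
Proof. exact: smooth_square_continuous. Qed.
Let F_C2 : C2 (fun t => F (circle_point t)).
Proof. exact: smooth_square_C2. Qed.

Lemma smooth_square_jordan : jordan_region (smooth_square e k m r).
Proof.
exists (gauge_curve F m r); first exact: gauge_jordan_curve.
by rewrite enclosed_gauge_curve.
Qed.

Lemma smooth_square_boundary : boundary (smooth_square e k m r) = gauge_curve F m r.
Proof. exact: boundary_gauge_region. Qed.

Lemma smooth_square_convex_smooth :
  convex_curve (boundary (smooth_square e k m r)) /\
  smooth_curve (boundary (smooth_square e k m r)).
Proof.
rewrite smooth_square_boundary; split; last exact: gauge_smooth_curve.
split; first exact: gauge_jordan_curve.
by move=> p q pC qC; rewrite enclosed_gauge_curve//; exact: segment_gauge_region.
Qed.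

Lemma smooth_square_strictly_convex_curve : 0 < k ->
  strictly_convex_curve (boundary (smooth_square e k m r)).
Proof.
move=> k0; split; first by have [] := smooth_square_convex_smooth.
rewrite smooth_square_boundary => p q; apply: gauge_strictly_convex.
by move=> z w; exact: smooth_square_strictly_convex.
Qed.

End SmoothSquareShape.

Lemma bij_countable_infinite (I : set (nat * nat)) (f : nat -> nat) :
  (forall n, I (n, f n)) -> exists g : nat -> nat * nat,
  [/\ forall i, I (g i), injective g & forall x, I x -> exists i, g i = x].
Proof.
move=> If.
have : (I #= [set: nat])%card.
  apply: eq_card_nat; first exact: countableP.
  have : ((fun n => (n, f n)) @` [set: nat] #= [set: nat])%card.
    by apply: inj_card_eq => x y _ _ [].
  rewrite card_eq_le => /andP[_ le].
  apply/infiniteP; apply: (card_le_trans le); apply: subset_card_le.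
  by move=> _ [n _ <-].
move=> /card_esym/pcard_eqP[g]; exists g; split.
- by move=> i; exact: funS.
- by move=> i j; apply: inj; rewrite in_setT.
- by move=> x /(@surj _ _ _ _ g)[i _ <-]; exists i.
Qed.

Lemma packing_exists (P : set (R * R) -> Prop) (good : R -> Prop) (s : nat -> R)
    Omega :
  (forall n, 0 < s n) ->
  (forall n eps, 0 < eps -> exists e k,
     [/\ 0 < e, e <= 1, 0 <= k & good k] /\
     (hausdorff_content (s n) eps (square_gap e k) <= eps%:E)%E) ->
  (forall e k m r, 0 < e -> e <= 1 -> 0 <= k -> 0 < r -> good k ->
     P (boundary (smooth_square e k m r))) ->
  open Omega -> Omega !=set0 ->
  exists (D A : nat -> set (R * R)) L,
  [/\ packing_by P Omega D,
      forall i, lipschitz_arc (A i),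
      forall n, (hausdorff_content (s n) (2 ^- n) L <= (2 ^- n)%:E)%E,
      residual_set Omega D `<=` L `|` \bigcup_i A i &
      exists a b y, a < b /\ forall x, a <= x < b -> residual_set Omega D (x, y)].
Proof.
move=> s0 shape PD oO O0.
have level n W : exists q : (nat -> Prop) * (nat -> set (R * R)) *
    (nat -> nat -> set (R * R)) * set (R * R), open W -> W !=set0 ->
    packing_level good (s n) (2 ^- n) W q.1.1.1 q.1.1.2 q.1.2 q.2.
  have [[oW W0]|h] := pselect (open W /\ W !=set0); last first.
    by exists ((fun=> True), (fun=> set0), (fun _ _ => set0), set0) => oW W0; case: h.
  have e0 : 0 < 2 ^- n :> R by rewrite invr_gt0 exprn_gt0.
  have e1 : 2 ^- n <= 1 :> R by rewrite invf_le1 ?exprn_gt0// exprn_ege1// ler1n.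
  have [act [D [A [W' h]]]] := packing_level_exists (s0 n) e0 e1 (shape n) oW W0.
  by exists (act, D, A, W').
have /choice[step stepP] : forall nW : nat * set (R * R), exists q : (nat -> Prop) *
    (nat -> set (R * R)) * (nat -> nat -> set (R * R)) * set (R * R),
    open nW.2 -> nW.2 !=set0 ->
    packing_level good (s nW.1) (2 ^- nW.1) nW.2 q.1.1.1 q.1.1.2 q.1.2 q.2.
  by move=> nW; exact: level.
pose fix W n := if n is n'.+1 then (step (n', W n')).2 else Omega.
pose act n := (step (n, W n)).1.1.1.
pose D n := (step (n, W n)).1.1.2.
pose A n := (step (n, W n)).1.2.
have lev n : packing_level good (s n) (2 ^- n) (W n) (act n) (D n) (A n) (W n.+1).
  suff [oW W0] : open (W n) /\ W n !=set0 by exact: (stepP (n, W n) oW W0).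
  elim: n => [//|n [oW W0]].
  have h := stepP (n, W n) oW W0; split; first exact: level_open h.
  exact: level_next_nonempty h.
have Wdec n d : W (n + d)%N `<=` W n.
  elim: d => [|d IH]; first by rewrite addn0.
  by rewrite addnS => z /(level_next_sub (lev (n + d)%N)); exact: IH.
have Wle n n' : (n <= n')%N -> W n' `<=` W n by move=> /subnKC <-; exact: Wdec.
have /choice[f fP] : forall n, exists i, act n i by move=> n; exact: level_active (lev n).
have [g [gI ginj gsurj]] := @bij_countable_infinite [set x | act x.1 x.2] f fP.
pose DD i := D (g i).1 (g i).2.
have DW n i : act n i -> D n i `<=` W n by exact: level_sub (lev n) i.
have DWS n i z : act n i -> D n i z -> ~ W n.+1 z.
  move=> ani Dz Wz; have : set0 z; last by [].
  by rewrite -(level_next_disjoint (lev n) ani).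
pose L := \bigcap_n W n.
pose AA (j : nat) : set (R * R) :=
  if unpickle j is Some (n, i, l) then A n i l else set0.
have DDdisj i j : i <> j -> DD i `&` DD j = set0.
  move=> ij; apply/seteqP; split => // z [].
  have gij : g i <> g j by move=> /ginj.
  move: gij (gI i) (gI j); rewrite /DD /=.
  case: (g i) => n a; case: (g j) => n' b /= gij na nb.
  have [nn'|nn'|nn'] := ltngtP n n'.
  - by move=> za /(DW _ _ nb)/(Wle _ _ nn'); exact: DWS na za.
  - by move=> /(DW _ _ na)/(Wle _ _ nn') zW zb; exact: DWS nb zb zW.
  - subst n'; move=> za zb; have ab : a <> b by move=> ab; apply: gij; rewrite ab.
    have : set0 z by rewrite -(level_disjoint (lev n) na nb ab).
    exact.
exists DD, AA, L; split.
- split; first split.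
  + move=> i; have [e [k [m [r [[e0 e1 k0 r0] [gk DE]]]]]] := level_shape (lev _) (gI i).
    rewrite /DD DE.
    exact: smooth_square_jordan.
  + by move=> i z /(DW _ _ (gI i)); exact: (Wle 0%N).
  + exact: DDdisj.
  + move=> i; have [e [k [m [r [[e0 e1 k0 r0] [gk DE]]]]]] := level_shape (lev _) (gI i).
    rewrite /DD DE.
    exact: PD.
- move=> j; rewrite /AA; case: unpickle => [[[n i] l]|]; last exact: lipschitz_arc_set0.
  exact: level_arc (lev n) i l.
- move=> n; apply: le_trans (level_content (lev n)).
  by apply: content_subset => z; apply.
- move=> z [Oz zD]; have [zL|zL] := pselect (L z); [by left|right].
  have ex : exists n, `[< ~ W n z >].
    apply: contrapT => h; apply: zL => n _; apply: contrapT => Wz.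
    by apply: h; exists n; exact/asboolP.
  case: (ex_minnP ex) => -[|n] /asboolP nW nmin; first by [].
  have Wz : W n z.
    apply: contrapT => Wz; have := nmin n; rewrite ltnn => h.
    by have : false by apply: h; exact/asboolP.
  have [//|[[i ai Dz]|[i _ [l _ Az]]]] := level_cover (lev n) Wz.
    by case: zD; have [j gj] := gsurj (n, i) ai; exists j => //; rewrite /DD gj.
  by exists (pickle (n, i, l)) => //; rewrite /AA pickleK.
- have [a [b [y [ab h]]]] := level_segment (lev 0%N).
  exists a, b, y; split => // x /h[Ox nW nD]; split; first exact: Ox.
  move=> [i _]; have := gI i; rewrite /DD /=.
  case: (g i) => -[|n] j /= anj; first exact: nD.
  by move=> /(DW _ _ anj) Wz; apply: nW; exact: (Wle 1%N n.+1).
Qed.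

Lemma hausdorff_dim_eq1 S : (forall s, 1 < s -> hausdorff_measure s S = 0%E) ->
  (exists a b y : R, a < b /\ forall x, a <= x < b -> S (x, y)) ->
  hausdorff_dim S = 1%:E.
Proof.
move=> S0 [a [b [y [ab Sab]]]]; apply/eqP; rewrite eq_le; apply/andP; split.
  apply/lee_addgt0Pr => e e0; apply: ereal_inf_lbound; exists (1 + e) => //=.
  by split; [lra|apply: S0; lra].
apply: le_ereal_inf_tmp => _ [s [s0 Ss] <-]; rewrite lee_fin leNgt; apply/negP => s1.
by have := @segment_measure_neq0 _ s a b y S ab; rewrite s0 s1 Ss eqxx => /(_ isT Sab).
Qed.

Lemma residual_measure0 S L (A : nat -> set (R * R)) (t : nat -> R) s :
  (forall n, 0 < t n) -> (\forall n \near \oo, t n <= s) -> 1 < s ->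
  (forall n, (hausdorff_content (t n) (2 ^- n) L <= (2 ^- n)%:E)%E) ->
  (forall i, lipschitz_arc (A i)) -> S `<=` L `|` \bigcup_i A i ->
  hausdorff_measure s S = 0%E.
Proof.
move=> t0 ts s1 hL hA SLA; apply: hausdorff_measure0_subset SLA _.
apply: hausdorff_measure0_setU.
  apply: (@content_le0_measure0 _ s (fun n => 2 ^- n) t) => //.
  under eq_fun do rewrite -exprVn.
  by apply: cvg_expr; rewrite ger0_norm// invf_lt1// ltr1n.
by apply: hausdorff_measure0_bigcup => i; exact: lipschitz_arc_measure0.
Qed.

End PackingConstruction.

Theorem theorem1p4 (R : realType) (Omega : set (R * R))
    (Omega_open : open Omega) (Omega_neq0 : Omega !=set0) :
  (exists D : nat -> set (R * R),
    [/\ packing_by (fun C => convex_curve C /\ smooth_curve C) Omega D,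
        sigma_finite_hausdorff1 (residual_set Omega D) &
        hausdorff_dim (residual_set Omega D) = 1%:E]) /\
  (exists D : nat -> set (R * R),
    packing_by (fun C => strictly_convex_curve C /\ smooth_curve C) Omega D /\
    hausdorff_dim (residual_set Omega D) = 1%:E).
Proof.
split.
- have [||D [A [L [packD arcA contL resLA seg]]]] := @packing_exists R
    (fun C => convex_curve C /\ smooth_curve C) (fun k => k = 0) (fun=> 1) Omega
    (fun=> ltr01) _ _ Omega_open Omega_neq0.
  + move=> _ eps eps0; have [e /andP[e0 e1] h] := corner_gap_content eps0.
    by exists e, 0.
  + by move=> e k m r *; exact: smooth_square_convex_smooth.
  exists D; split => //.
  + exists (fun j => residual_set Omega D `&` (if j is i.+1 then A i else L)).
      rewrite -setI_bigcupr; apply/esym/setIidPl => z /resLA[zL|[i _ zA]].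
        by exists 0%N.
      by exists i.+1.
    have L0 : hausdorff_measure 1 L = 0%E.
      apply: (@content_le0_measure0 _ 1 (fun n => 2 ^- n) (fun=> 1)) => //.
        exact: nearW.
      under eq_fun do rewrite -exprVn.
      by apply: cvg_expr; rewrite ger0_norm// invf_lt1// ltr1n.
    move=> [|i].
      by rewrite (hausdorff_measure0_subset _ L0)// => z [].
    by apply: lipschitz_arc_measure1; apply: lipschitz_arc_subset (arcA i) => z [].
  + apply: hausdorff_dim_eq1 seg => s s1.
    apply: (@residual_measure0 _ _ L A (fun=> 1)) => //.
    by apply: nearW => _; exact: ltW.
- pose t (n : nat) : R := 1 + n.+1%:R^-1.
  have t1 n : 1 < t n by rewrite ltrDl invr_gt0.
  have [|||D [A [L [packD arcA contL resLA seg]]]] := @packing_exists R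
    (fun C => strictly_convex_curve C /\ smooth_curve C) (fun k => 0 < k) t Omega
    _ _ _ Omega_open Omega_neq0.
  + by move=> n; exact: lt_trans (t1 n).
  + move=> n eps eps0; have [e /andP[e0 e1] h] := ring_gap_content (t1 n) eps0.
    by exists e, e; split => //; split => //; exact: ltW.
  + move=> e k m r e0 e1 k0 r0 k_gt0; split.
      exact: smooth_square_strictly_convex_curve.
    by have [] := @smooth_square_convex_smooth _ _ _ r m e0 e1 k0 r0.
  exists D; split => //; apply: hausdorff_dim_eq1 seg => s s1.
  apply: (@residual_measure0 _ _ L A t) => //.
    by move=> n; exact: lt_trans (t1 n).
  have s10 : 0 < s - 1 by rewrite subr_gt0.
  near=> n; rewrite /t -lerBrDl; apply/ltW; near: n.
  exact: (near_infty_natSinv_lt (PosNum s10)).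
Unshelve. all: by end_near. Qed.
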